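(* Let $\vartheta>0$ be a constant and let $g$ be the completely multiplicative function on permutation divisors defined by $g_j(1)=\vartheta$ for all $j\ge 1$, i.e. $g(\delta)=\vartheta^{w(\delta)}$, where $w(\delta)$ is the number of cycles in the divisor $\delta$. For $n\in\mathbb N$ let $P_n$ be the distribution on the Skorokhod space $\mathbb D[0,1]$ of the process $X_n=X_n(\sigma,\cdot)$, when $\sigma$ is drawn uniformly at random from the symmetric group $\mathbb S_n$, where $$X_n(\sigma,t)=\frac{1}{f(\sigma)}\sum_{\substack{\delta\mid\sigma\\ |\delta|\le tn}} g(\delta),\quad 0\le t\le 1,\qquad f(\sigma)=\sum_{\delta\mid\sigma}g(\delta).$$ Then the sequence $P_n$ converges weakly as $n\to\infty$ to a limiting probability measure $P$ on $\mathbb D[0,1]$, and $P$ is supported by a subset of $C[0,1]$, the space of continuous functions on $[0,1]$.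
   Context: Every permutation $\sigma\in\mathbb S_n$ of $\{1,\dots,n\}$ decomposes uniquely into a set of disjoint cycles $\{\varkappa_1,\dots,\varkappa_w\}$ (fixed points count as cycles of length 1). A divisor $\delta$ of $\sigma$, written $\delta\mid\sigma$, is any subset (including the empty one) of this set of cycles. For a divisor $\delta$, $k_j(\delta)$ is the number of cycles of length $j$ in $\delta$, $w(\delta)=\sum_j k_j(\delta)$ is its number of cycles, and $|\delta|=\sum_{j\le n} jk_j(\delta)$ is its size. A completely multiplicative function $g$ is one of the form $g(\delta)=\prod_{j\le n} g_j(1)^{k_j(\delta)}$. $\nu_n$ denotes the uniform probability measure on $\mathbb S_n$. $\mathbb D[0,1]$ is the space of right-continuous functions on $[0,1]$ with left limits, with the Skorokhod topology and its Borel $\sigma$-algebra $\mathcal D$. The distribution is $P_n(A)=\nu_n(\sigma\in\mathbb S_n:\ X_n(\sigma,\cdot)\in A)$ for $A\in\mathcal D$. *)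

(* Defs.v *)
From HB Require Import structures.
From mathcomp Require Import all_boot all_order all_algebra all_fingroup.
From mathcomp Require Import all_classical all_reals all_analysis.

Set Implicit Arguments.
Unset Strict Implicit.
Unset Printing Implicit Defensive.

Import Order.TTheory GRing.Theory Num.Theory.
Import numFieldNormedType.Exports.

Local Open Scope classical_set_scope.
Local Open Scope ring_scope.

Definition cadlag {R : realType} (x : R -> R) : Prop :=
  (forall t, 0 <= t < 1 -> x @ t^'+ --> x t) /\
  (forall t, 0 < t <= 1 -> cvg (x @ t^'-)).

(* Only the values on [0, 1] matter; a function on [0, 1] is represented by its
   extension by 0 to R, so that equality is equality of functions on [0, 1].
   [cadlag] takes no limit from outside [0, 1]. *)
Record skorokhod (R : realType) := Skorokhod {
  skorokhod_fun :> R -> R ;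
  skorokhod_cadlag : cadlag skorokhod_fun ;
  skorokhod_out : skorokhod_fun \_ `[0, 1]%classic = skorokhod_fun }.

Section skorokhod_topology.
Context {R : realType}.
Implicit Types (l : R -> R) (x y z : skorokhod R).

Definition time_change l : Prop :=
  [/\ {within `[0, 1], continuous l},
      {in `[0, 1] &, {homo l : s t / s < t}} &
      l @` `[0, 1]%classic = `[0, 1]%classic].

(* The open ball of the Skorokhod metric: the infimum of the r >= 0 such that,
   for some time change l, |l - id| and |x - y \o l| are at most r on [0, 1],
   is smaller than e. *)
Definition skorokhod_ball x (e : R) y : Prop :=
  exists l (r : R), [/\ time_change l, r < e &
    forall t, t \in `[0, 1] -> `|l t - t| <= r /\ `|x t - y (l t)| <= r].

Lemma time_change_in l t : time_change l -> t \in `[0, 1] -> l t \in `[0, 1].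
Proof.
move=> [_ _ lI] t01; have : (l @` `[0, 1]%classic) (l t) by exists t.
by rewrite lI.
Qed.

Lemma skorokhod_ball_center x (e : R) : 0 < e -> skorokhod_ball x e x.
Proof.
move=> e0; exists idfun, 0; split => //.
- split => //; last by rewrite image_id.
  by apply: continuous_subspaceT => ?; exact: cvg_id.
- by move=> t _ /=; rewrite !subrr normr0.
Qed.

Lemma time_change_inv l : time_change l ->
  exists2 k, time_change k &
    forall t, t \in `[0, 1] -> k t \in `[0, 1] /\ l (k t) = t.
Proof.
move=> tl; have [_ linc lI] := tl.
have lmono : {in `[0, 1] &, {mono l : s t / s <= t}} by exact: le_mono_in.
have linj := inc_inj_in lmono.
have H t : exists s, t \in `[0, 1] -> s \in `[0, 1] /\ l s = t.
  have [t01|t01] := boolP (t \in `[0, 1]); last by exists 0.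
  have : (l @` `[0, 1]%classic) t by rewrite lI.
  by case=> s s01 lst; exists s.
have [k kP] := choice H.
exists k => //.
have kinc : {in `[0, 1] &, {homo k : s t / s < t}}.
  move=> s t s01 t01 st; have [ks lks] := kP _ s01; have [kt lkt] := kP _ t01.
  by rewrite ltNge -lmono// lks lkt -ltNge.
have kl s : s \in `[0, 1] -> k (l s) = s.
  move=> s01; have ls01 := time_change_in tl s01.
  by have [? ?] := kP _ ls01; exact: linj.
have ksurj : k @` `[0, 1]%classic = `[0, 1]%classic.
  apply/seteqP; split => [_ [t t01 <-]|s s01]; first by have [] := kP _ t01.
  by exists (l s); [exact: time_change_in tl s01|exact: kl].
have kmono : {in `[0, 1] &, {mono k : s t / s <= t}} by exact: le_mono_in.
split => //.
have m0 : (0 : R) \in `[0, 1] by rewrite in_itv/= lexx ler01.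
have m1 : (1 : R) \in `[0, 1] by rewrite in_itv/= lexx ler01.
have k0 : k 0 = 0.
  have [s s01 ks] : (k @` `[0, 1]%classic) 0 by rewrite ksurj.
  apply/eqP; rewrite eq_le; apply/andP; split.
    by rewrite -{2}ks kmono//; move: s01; rewrite /= in_itv/= => /andP[].
  by have [] := kP _ m0; rewrite in_itv/= => /andP[].
have k1 : k 1 = 1.
  have [s s01 ks] : (k @` `[0, 1]%classic) 1 by rewrite ksurj.
  apply/eqP; rewrite eq_le; apply/andP; split.
    by have [] := kP _ m1; rewrite in_itv/= => /andP[].
  by rewrite -{1}ks kmono//; move: s01; rewrite /= in_itv/= => /andP[].
apply: segment_inc_surj_continuous => //.
by rewrite k0 k1 /set_surj ksurj.
Qed.

Lemma skorokhod_ball_sym x y (e : R) :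
  skorokhod_ball x e y -> skorokhod_ball y e x.
Proof.
move=> [l [r [tl re lr]]]; have [k tk kP] := time_change_inv tl.
exists k, r; split => // t t01; have [kt lkt] := kP _ t01.
by have := lr _ kt; rewrite lkt => -[? ?]; split; rewrite distrC.
Qed.

Lemma skorokhod_ball_triangle x y z (e1 e2 : R) : skorokhod_ball x e1 y ->
  skorokhod_ball y e2 z -> skorokhod_ball x (e1 + e2) z.
Proof.
move=> [l [r [tl re lr]]] [k [q [tk qe kq]]].
exists (k \o l), (r + q); split; last 2 first.
- exact: ltrD.
- move=> t t01; have lt01 := time_change_in tl t01.
  have [? ?] := lr _ t01; have [? ?] := kq _ lt01; split => /=.
    rewrite -(subrK (l t) (k (l t))) -addrA addrC.
    by rewrite (le_trans (ler_normD _ _))// lerD.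
  rewrite -(subrK (y (l t)) (x t)) -addrA.
  by rewrite (le_trans (ler_normD _ _))// lerD.
- have [lc li lI] := tl; have [kc ki kI] := tk; split.
  + have m0 : (0 : R) \in `[0, 1] by rewrite in_itv/= lexx ler01.
    have m1 : (1 : R) \in `[0, 1] by rewrite in_itv/= lexx ler01.
    have klmono : {in `[0, 1] &, {mono (k \o l) : s t / s <= t}}.
      apply: le_mono_in => s t s01 t01 st /=.
      apply: ki; [exact: time_change_in tl _|exact: time_change_in tl _|].
      exact: li.
    apply: segment_inc_surj_continuous => // s /= sI.
    have : s \in `[0, 1].
      move: sI; rewrite !in_itv/= => /andP[s0 s1].
      have k01 t : t \in `[0, 1] -> k (l t) \in `[0, 1].
        by move=> ?; do 2 apply: time_change_in => //.
      have := k01 _ m0; have := k01 _ m1; rewrite !in_itv/=.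
      move=> /andP[_ h1] /andP[h0 _].
      by rewrite (le_trans h0 s0) (le_trans s1 h1).
    move=> s01; have [u u01 <-] : (k @` `[0, 1]%classic) s by rewrite kI.
    have [v v01 <-] : (l @` `[0, 1]%classic) u by rewrite lI.
    by exists v.
  + move=> s t s01 t01 st /=.
    by apply: ki; [exact: time_change_in tl _|exact: time_change_in tl _|exact: li].
  + by rewrite -image_comp lI.
Qed.

Lemma cadlag_cst0 : cadlag (cst 0 : R -> R).
Proof. by split => t _; [exact: cvg_cst|exact: is_cvg_cst]. Qed.

Lemma cst0_out : (cst 0 : R -> R) \_ `[0, 1]%classic = cst 0.
Proof. by apply/funext => t; rewrite patchE; case: ifP. Qed.

End skorokhod_topology.

Section skorokhod_instances.
Variable R : realType.

HB.instance Definition _ := gen_eqMixin (skorokhod R).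
HB.instance Definition _ := gen_choiceMixin (skorokhod R).
HB.instance Definition _ :=
  isPointed.Build (skorokhod R) (Skorokhod (@cadlag_cst0 R) (@cst0_out R)).
HB.instance Definition _ :=
  hasNbhs.Build (skorokhod R) (nbhs_ (entourage_ (@skorokhod_ball R))).
HB.instance Definition _ := @Nbhs_isPseudoMetric.Build R (skorokhod R)
  (entourage_ (@skorokhod_ball R)) erefl (@skorokhod_ball R)
  (@skorokhod_ball_center R) (@skorokhod_ball_sym R)
  (@skorokhod_ball_triangle R) erefl.

HB.instance Definition _ :=
  @isMeasurable.Build (sigma_display (@open (skorokhod R))) (skorokhod R)
    <<s (@open (skorokhod R)) >> (@sigma_algebra0 _ setT (@open (skorokhod R)))
    (@sigma_algebraC _ (@open (skorokhod R)))
    (@sigma_algebra_bigcup _ setT (@open (skorokhod R))).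

End skorokhod_instances.

Definition C01 (R : realType) : set (skorokhod R) :=
  [set x : skorokhod R | {within `[0, 1], continuous x}].

Definition weakly_cvg (R : realType)
    (P_ : nat -> probability (skorokhod R) R) (P : probability (skorokhod R) R)
    : Prop :=
  forall f : skorokhod R -> R, continuous f -> bounded_fun f ->
    (\int[P_ n]_x (f x)%:E)%E @[n --> \oo] --> (\int[P]_x (f x)%:E)%E.

HB.instance Definition _ (T : finType) := isPointed.Build (perm_type T) 1%g.
HB.instance Definition _ (T : finType) :=
  @isMeasurable.Build default_measure_display (perm_type T) discrete_measurable
    discrete_measurable0 discrete_measurableC discrete_measurableU.

Section uniform_permutation.
Context {R : realType} (n : nat).

Definition uniform_perm (A : set {perm 'I_n}) : \bar R :=
  (#|[set s : {perm 'I_n} | s \in A]%SET|%:R / n`!%:R)%:E.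

Let nu0 : uniform_perm set0 = 0%E.
Proof.
rewrite /uniform_perm (_ : [set s | s \in _]%SET = finset.set0) ?cards0 ?mul0r//.
apply/setP => s; rewrite finset.in_set0 finset.in_set.
by apply/negbTE; rewrite notin_setE.
Qed.

Let nu_ge0 A : (0 <= uniform_perm A)%E.
Proof. by rewrite lee_fin divr_ge0. Qed.

Let sum_dirac : {measure set {perm 'I_n} -> \bar R} :=
  msum (fun k => \d_(nth 1%g (enum {: {perm 'I_n}}) k)) #|{: {perm 'I_n}}|.

Let invf_fact_ge0 : 0 <= (n`!%:R)^-1 :> R. Proof. by rewrite invr_ge0. Qed.

Let nuE : uniform_perm = mscale (NngNum invf_fact_ge0) sum_dirac.
Proof.
apply/funext => A; rewrite /mscale.
have -> : sum_dirac A = (\sum_(s : {perm 'I_n}) (s \in A)%:R : R)%:E.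
  transitivity (\sum_(k < #|{: {perm 'I_n}}|)
    \d_(nth 1%g (enum {: {perm 'I_n}}) k) A : \bar R)%E; first by [].
  rewrite cardE.
  rewrite -(big_mkord xpredT (fun k => \d_(nth 1%g (enum {: {perm 'I_n}}) k) A)).
  rewrite -(big_nth _ xpredT (fun s : {perm 'I_n} => \d_s A)) big_enum /=.
  by rewrite -sumEFin; apply: eq_bigr => s _; rewrite -diracE.
rewrite -EFinM mulrC -natr_sum; congr (_%:R / _)%:E.
rewrite -sum1_card big_mkcond; apply: eq_bigr => s _.
by rewrite finset.in_set; case: (s \in A).
Qed.

Let nu_sigma_additive : semi_sigma_additive uniform_perm.
Proof. by rewrite nuE; exact: measure_semi_sigma_additive. Qed.

HB.instance Definition _ :=
  isMeasure.Build _ _ _ uniform_perm nu0 nu_ge0 nu_sigma_additive.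

Let nu_setT : uniform_perm setT = 1%E.
Proof.
rewrite /uniform_perm (_ : [set s | s \in _]%SET = finset.setT).
  by rewrite cardsT card_Sn divff// pnatr_eq0 -lt0n fact_gt0.
by apply/setP => s; rewrite finset.in_setT finset.in_set mem_set.
Qed.

HB.instance Definition _ := Measure_isProbability.Build _ _ _ uniform_perm nu_setT.

End uniform_permutation.

Section permutation_divisors.
Context {R : realType} {n : nat}.
Implicit Types (s : {perm 'I_n}) (d : {set {set 'I_n}}).

(* A cycle is represented by its support. *)
Definition perm_divisors s : {set {set {set 'I_n}}} := powerset (porbits s).

Definition ncycles (j : nat) d : nat := #|[set c in d | #|c| == j]%SET|.

Definition dcycles d : nat := (\sum_(1 <= j < n.+1) ncycles j d)%N.

Definition dsize d : nat := (\sum_(1 <= j < n.+1) j * ncycles j d)%N.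

Definition cmult (gj : nat -> R) d : R :=
  \prod_(1 <= j < n.+1) gj j ^+ ncycles j d.

Lemma cmult_cst (a : R) d : cmult (fun=> a) d = a ^+ dcycles d.
Proof. by rewrite /cmult /dcycles expr_sum. Qed.

Definition divisor_total (gj : nat -> R) s : R :=
  \sum_(d in perm_divisors s) cmult gj d.

Definition process_fun (gj : nat -> R) s (t : R) : R :=
  (divisor_total gj s)^-1 *
  \sum_(d in perm_divisors s | (dsize d)%:R <= t * n%:R) cmult gj d.

Lemma size_le_near (m : nat) (t : R) :
  (\forall u \near t^'+, (m%:R <= u * n%:R) = (m%:R <= t * n%:R)) /\
  (exists b : bool, \forall u \near t^'-, (m%:R <= u * n%:R) = b).
Proof.
have [n0|n0] := posnP n.
  split; last (exists (m%:R <= 0 :> R)); near=> u; by rewrite n0 !mulr0.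
have nR0 : 0 < n%:R :> R by rewrite ltr0n.
split.
  have [mt|mt] := leP m%:R (t * n%:R).
    near=> u; suff tu : t < u by rewrite (le_trans mt)// ler_pM2r// ltW.
    by near: u; exact: nbhs_right_gt.
  near=> u; apply/negbTE; rewrite -ltNge -ltr_pdivlMr//.
  by near: u; apply: nbhs_right_lt; rewrite ltr_pdivlMr.
have [mt|mt] := ltP m%:R (t * n%:R).
  exists true; near=> u; rewrite -ler_pdivrMr//.
  suff /ltW -> : m%:R / n%:R < u by [].
  by near: u; apply: nbhs_left_gt; rewrite ltr_pdivrMr.
exists false; near=> u; apply/negbTE; rewrite -ltNge (lt_le_trans _ mt)//.
by rewrite ltr_pM2r//; near: u; exact: nbhs_left_lt.
Unshelve. all: by end_near. Qed.

Lemma process_cadlag (gj : nat -> R) s :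
  cadlag (process_fun gj s \_ `[0, 1]%classic).
Proof.
pose F (d : {set {set 'I_n}}) (u : R) : R :=
  (if (dsize d)%:R <= u * n%:R then cmult gj d else 0).
have pE u : process_fun gj s u =
    (divisor_total gj s)^-1 * \sum_(d in perm_divisors s) F d u.
  by rewrite /process_fun big_mkcondr.
have FT (G : set_system R) (fG : Filter G) (c : {set {set 'I_n}} -> R) :
    (forall d, \forall u \near G, F d u = c d) ->
    process_fun gj s @ G -->
      (divisor_total gj s)^-1 * \sum_(d in perm_divisors s) c d.
  move=> Gc; rewrite (funext pE); apply: cvgM; first exact: cvg_cst.
  apply: cvg_big; first exact: add_continuous.
  by move=> d _; apply: cvg_near_cst; exact: Gc.
have out u : u \in `[0, 1] ->
    (process_fun gj s \_ `[0, 1]%classic) u = process_fun gj s u.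
  by move=> u01; rewrite patchE mem_set.
split=> t /andP[t0 t1].
- rewrite out ?in_itv/= ?t0 ?ltW// pE.
  have : process_fun gj s @ t^'+ -->
      (divisor_total gj s)^-1 * \sum_(d in perm_divisors s) F d t.
    apply: FT => d; have [Hd _] := size_le_near (dsize d) t.
    by apply: filterS Hd => u; rewrite /F => ->.
  apply: cvg_trans; apply: near_eq_cvg; near=> u; rewrite out// in_itv/=.
  apply/andP; split; last by near: u; exact: nbhs_right_le.
  by rewrite (le_trans t0)// ltW//; near: u; exact: nbhs_right_gt.
- have H d : exists b : bool,
      \forall u \near t^'-, ((dsize d)%:R <= u * n%:R) = b.
    by have [] := size_le_near (dsize d) t.
  have [b bP] := choice H.
  apply/cvg_ex; eexists.
  apply: (@cvg_trans _ (process_fun gj s @ t^'-)); last first.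
    apply: (FT _ _ (fun d => if b d then cmult gj d else 0)) => d.
    by apply: filterS (bP d) => u; rewrite /F => ->.
  apply: near_eq_cvg; near=> u; rewrite out// in_itv/=.
  apply/andP; split; first by near: u; exact: nbhs_left_ge.
  have ut : u < t by near: u; exact: nbhs_left_lt.
  by rewrite (le_trans (ltW ut)).
Unshelve. all: by end_near. Qed.

Lemma process_out (gj : nat -> R) s :
  (process_fun gj s \_ `[0, 1]%classic) \_ `[0, 1]%classic =
  process_fun gj s \_ `[0, 1]%classic.
Proof. by rewrite -patch_setI setIid. Qed.

Definition process (gj : nat -> R) s : skorokhod R :=
  Skorokhod (@process_cadlag gj s) (process_out gj s).

Let measurable_process (gj : nat -> R) : measurable_fun setT (process gj).
Proof. by []. Qed.

HB.instance Definition _ (gj : nat -> R) :=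
  isMeasurableFun.Build _ _ _ _ (process gj) (measurable_process gj).

End permutation_divisors.

Definition process_law (R : realType) (gj : nat -> R) (n : nat) :
    probability (skorokhod R) R :=
  distribution (@uniform_perm R n) (@process R n gj).

(* Main.v *)
Require Import Defs.
From HB Require Import structures.
From mathcomp Require Import all_boot all_order all_algebra all_fingroup.
From mathcomp Require Import all_classical all_reals all_analysis.
From mathcomp Require Import measurable_realfun ring lra zify.

Set Implicit Arguments.
Unset Strict Implicit.
Unset Printing Implicit Defensive.

Import Order.TTheory GRing.Theory Num.Theory.
Import numFieldNormedType.Exports.

Local Open Scope classical_set_scope.
Local Open Scope ring_scope.

(* With [p = theta / (1 + theta)], the value [X_n(sigma, t)] is the probability
   that [S_n <= t n], where [S_n] is the total size of a set of cycles of [sigma]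
   to which each cycle belongs independently with probability [p].  Grow [sigma]
   by the Chinese restaurant process, all of whose choices are read off the digits
   of one uniform variable: then [E |S_m/m - S_n/n|^2 <= 1/n] for [m >= n].  The
   mass that the law of [S_n] given [sigma] puts on a window is at most the square
   root of the probability that two independent copies of [S_n] are close to each
   other, and by the explicit law of a three-colour Polya urn this probability is
   small in mean, uniformly in [n], for windows of length [h n] with [h] small.
   Hence [X_n] is a Cauchy sequence in probability for the uniform norm, with
   vanishing jumps; the limit is continuous and its law is [P]. *)

(** * Finite expectations *)

Section finite_expectation.
Context {R : realType}.

(** The value of [p] comes from [1 + theta X^a = (1 + theta) ((1 - p) + p X^a)]: normalising a
    divisor sum turns it into independent coin tosses, one for each cycle. The laws for different
    [n] are unrelated as given; coupling all sizes replaces tightness and finite-dimensional limits.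
    The obstacle is that an L2 estimate on [S_m/m - S_n/n] says nothing about distribution functions
    in the uniform norm unless the law of [S_n/n] given [sigma] is spread out. This fails for some
    [sigma] (for the identity, [S_n/n] concentrates at [p]), so spreading is only proved on average
    over [sigma], where sizes and colours together have an explicit law. Cycles on which the two
    copies agree cancel in the difference, which leaves three colours with urn weights [q], [q],
    [1 - 2q], where [q = p (1 - p)]. Two accidents make the difference small: nearly equal amounts
    of the first two colours, unlikely because weights [q <= 1] push mass away from the diagonal,
    and too little of both, unlikely because [1 - 2q < 1]. *)

Definition fexp {T : Type} (mu : seq (R * T)) (F : T -> R) : R :=
  \sum_(x <- mu) x.1 * F x.2.

Definition fdist {T : Type} (mu : seq (R * T)) : Prop :=
  all (fun x => 0 <= x.1) mu /\ \sum_(x <- mu) x.1 = 1.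

Lemma eq_fexp {T : Type} (mu : seq (R * T)) (F G : T -> R) :
  F =1 G -> fexp mu F = fexp mu G.
Proof. by move=> FG; apply: eq_bigr => x _; rewrite FG. Qed.

Lemma eq_fexp_in {T : eqType} (mu : seq (R * T)) (F G : T -> R) :
  (forall x, x \in mu -> F x.2 = G x.2) -> fexp mu F = fexp mu G.
Proof. by move=> FG; apply: eq_big_seq => x /FG ->. Qed.

Lemma fexpD {T : Type} (mu : seq (R * T)) (F G : T -> R) :
  fexp mu (fun x => F x + G x) = fexp mu F + fexp mu G.
Proof. by rewrite -big_split; apply: eq_bigr => x _; rewrite mulrDr. Qed.

Lemma fexpZ {T : Type} (mu : seq (R * T)) (a : R) (F : T -> R) :
  fexp mu (fun x => a * F x) = a * fexp mu F.
Proof. by rewrite [RHS]mulr_sumr; apply: eq_bigr => x _; rewrite mulrCA. Qed.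

Lemma fexpZr {T : Type} (mu : seq (R * T)) (a : R) (F : T -> R) :
  fexp mu (fun x => F x * a) = fexp mu F * a.
Proof. by rewrite mulrC -fexpZ; apply: eq_fexp => x; rewrite mulrC. Qed.

Lemma fexpB {T : Type} (mu : seq (R * T)) (F G : T -> R) :
  fexp mu (fun x => F x - G x) = fexp mu F - fexp mu G.
Proof.
rewrite fexpD -[X in _ = _ + X]mulN1r -fexpZ; congr (_ + _).
by apply: eq_fexp => x; rewrite mulN1r.
Qed.

Lemma fexp_sum {T I : Type} (mu : seq (R * T)) (r : seq I) (P : pred I)
    (F : I -> T -> R) :
  fexp mu (fun x => \sum_(i <- r | P i) F i x) =
  \sum_(i <- r | P i) fexp mu (F i).
Proof.
by rewrite exchange_big; apply: eq_bigr => x _; rewrite mulr_sumr.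
Qed.

Lemma fexp_cst {T : Type} (mu : seq (R * T)) (a : R) :
  fdist mu -> fexp mu (fun=> a) = a.
Proof. by case=> _ mu1; rewrite /fexp -mulr_suml mu1 mul1r. Qed.

Lemma fexp_le_in {T : eqType} (mu : seq (R * T)) (F G : T -> R) : fdist mu ->
  (forall x, x \in mu -> F x.2 <= G x.2) -> fexp mu F <= fexp mu G.
Proof.
move=> [/allP mu0 _] FG; rewrite /fexp !big_seq; apply: ler_sum => x xmu.
by rewrite ler_wpM2l ?FG ?mu0.
Qed.

Lemma fexp_le {T : Type} (mu : seq (R * T)) (F G : T -> R) : fdist mu ->
  (forall x, F x <= G x) -> fexp mu F <= fexp mu G.
Proof.
move=> [mu0 _] FG; rewrite /fexp; elim: mu mu0 => [|x mu IH]; first by rewrite !big_nil.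
by move=> /= /andP[x0 mu0]; rewrite !big_cons lerD ?ler_wpM2l ?IH.
Qed.

Lemma fexp_ge0 {T : Type} (mu : seq (R * T)) (F : T -> R) : fdist mu ->
  (forall x, 0 <= F x) -> 0 <= fexp mu F.
Proof. by move=> mud F0; rewrite -(fexp_cst 0 mud) fexp_le. Qed.

Definition fpair {S T U : Type} (f : S -> T -> U) (mu : seq (R * S))
    (nu : seq (R * T)) : seq (R * U) :=
  [seq (x.1 * y.1, f x.2 y.2) | x <- mu, y <- nu].

Lemma fexp_fpair {S T U : Type} (f : S -> T -> U) mu nu (F : U -> R) :
  fexp (fpair f mu nu) F = fexp mu (fun x => fexp nu (fun y => F (f x y))).
Proof.
rewrite /fexp /fpair big_allpairs_dep; apply: eq_bigr => x _.
by rewrite mulr_sumr; apply: eq_bigr => y _; rewrite mulrA.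
Qed.

Lemma fdist_fpair {S T U : Type} (f : S -> T -> U) mu nu :
  fdist mu -> fdist nu -> fdist (fpair f mu nu).
Proof.
move=> [mu0 mu1] [nu0 nu1]; split.
  rewrite /fpair; elim: mu mu0 {mu1} => //= x mu IH /andP[x0 mu0].
  rewrite all_cat IH// andbT; elim: nu nu0 {nu1 IH} => //= y nu IH /andP[y0 nu0].
  by rewrite mulr_ge0// IH.
rewrite /fpair big_allpairs_dep /=; rewrite -[RHS]mu1; apply: eq_bigr => x _.
by rewrite -mulr_sumr nu1 mulr1.
Qed.

(** Drawing the new colour at the end matches the opening of a table: the colour of table [j] stays
    at index [j]. *)
Fixpoint colourings {K : Type} (w : seq (R * K)) (N : nat) : seq (R * seq K) :=
  if N is M.+1 then fpair rcons (colourings w M) w else [:: (1, [::])].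

Lemma fdist_colourings {K : Type} (w : seq (R * K)) N :
  fdist w -> fdist (colourings w N).
Proof.
move=> wd; elim: N => [|N IH]; last exact: fdist_fpair.
by split; rewrite /= ?ler01// big_cons big_nil addr0.
Qed.

Lemma colouring_size {K : eqType} (w : seq (R * K)) N x :
  x \in colourings w N -> size x.2 = N.
Proof.
elim: N x => [|N IH] x /=; first by rewrite inE => /eqP ->.
by move=> /allpairsP[[y k] [/= yN _ ->]]; rewrite size_rcons IH.
Qed.

Lemma fexp_colouringS {K : Type} (w : seq (R * K)) N F :
  fexp (colourings w N.+1) F =
  fexp (colourings w N) (fun s => fexp w (fun k => F (rcons s k))).
Proof. exact: fexp_fpair. Qed.

Lemma fexp_colouring0 {K : Type} (w : seq (R * K)) F :
  fexp (colourings w 0) F = F [::].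
Proof. by rewrite /fexp big_cons big_nil addr0 mul1r. Qed.

(** Colours that are not read integrate out. This lets two table lists of different lengths share
    one colouring. *)
Lemma fexp_colouring_widen {K : eqType} (w : seq (R * K)) M N F : fdist w ->
  (M <= N)%N ->
  (forall s k, (M <= size s)%N -> F (rcons s k) = F s) ->
  fexp (colourings w N) F = fexp (colourings w M) F.
Proof.
move=> wd /subnK <-; elim: (N - M)%N => // k IH FM; rewrite addSn fexp_colouringS.
rewrite -IH//; apply: eq_fexp_in => x /colouring_size xs.
rewrite (@eq_fexp _ _ _ (fun=> F x.2)) ?fexp_cst// => y; rewrite FM//.
by rewrite xs leq_addl.
Qed.

Lemma fexp_colouring_pair {K L : Type} (w : seq (R * K)) (v : seq (R * L)) N F G :
  fexp (colourings (fpair pair w v) N)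
    (fun s => F (unzip1 s) * G (unzip2 s)) =
  fexp (colourings w N) F * fexp (colourings v N) G.
Proof.
elim: N F G => [|N IH] F G; first by rewrite !fexp_colouring0.
rewrite !fexp_colouringS -IH; apply: eq_fexp => s; rewrite fexp_fpair.
rewrite -fexpZr; apply: eq_fexp => k; rewrite -fexpZ; apply: eq_fexp => l.
by rewrite /unzip1 /unzip2 !map_rcons.
Qed.

Definition unif (n : nat) : seq (R * nat) := [seq (n%:R^-1, i) | i <- iota 0 n].

Lemma fexp_unif n F : fexp (unif n) F = n%:R^-1 * \sum_(i < n) F i.
Proof.
rewrite /fexp /unif big_map /= mulr_sumr -[X in iota 0 X]subn0 -/(index_iota 0 n).
by rewrite big_mkord.
Qed.

Lemma fdist_unif n : (0 < n)%N -> fdist (unif n).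
Proof.
move=> n0; split; first by rewrite all_map /=; apply/allP => i _ /=; rewrite invr_ge0.
have := fexp_unif n (fun=> 1); rewrite /fexp; under eq_bigr do rewrite mulr1.
by move=> ->; rewrite sumr_const card_ord mulVf// pnatr_eq0 -lt0n.
Qed.

(** The most recent digit is at the head, so that [drop k] returns to the state before the last [k]
    customers in the same realisation. *)
Fixpoint digits (n : nat) : seq (R * seq nat) :=
  if n is m.+1 then fpair (fun ds i => i :: ds) (digits m) (unif n)
  else [:: (1, [::])].

Lemma fdist_digits n : fdist (digits n).
Proof.
elim: n => [|n IH]; last by apply: fdist_fpair => //; exact: fdist_unif.
by split; rewrite /= ?ler01// big_cons big_nil addr0.
Qed.

Lemma digits_size n x : x \in digits n -> size x.2 = n.
Proof.
elim: n x => [|n IH] x /=; first by rewrite inE => /eqP ->.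
by move=> /allpairsP[[y k] [/= yN _ ->]] /=; rewrite IH.
Qed.

Lemma fexp_digitsS n F : fexp (digits n.+1) F =
  fexp (digits n) (fun ds => n.+1%:R^-1 * \sum_(i < n.+1) F ((i : nat) :: ds)).
Proof.
rewrite /= fexp_fpair; apply: eq_fexp => ds.
exact: fexp_unif.
Qed.

Lemma fexp_digits0 F : fexp (digits 0) F = F [::].
Proof. by rewrite /fexp big_cons big_nil addr0 mul1r. Qed.

End finite_expectation.

(** * The Chinese restaurant process *)

(** The customers are cut into consecutive blocks of lengths [l]. A digit past the last block yields
    [size l], the index at which [incr_nth] opens a new table. *)
Fixpoint table (l : seq nat) (i : nat) : nat :=
  if l is a :: l' then (if (i < a)%N then 0%N else (table l' (i - a)).+1) else 0%N.

(* Customer [n] picks a digit [i <= n]; the digits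
   [i < n] select a table with multiplicity its size, [i = n] a new table. *)
Fixpoint tables (ds : seq nat) : seq nat :=
  if ds is i :: ds' then incr_nth (tables ds') (table (tables ds') i) else [::].

Lemma table_le l i : (table l i <= size l)%N.
Proof. by elim: l i => //= a l IH i; case: ifP => // _; exact: IH. Qed.

Lemma sum_table {V : nmodType} (l : seq nat) (H : nat -> V) :
  \sum_(i < (sumn l).+1) H (table l i) =
  \sum_(j < size l) H j *+ nth 0%N l j + H (size l).
Proof.
elim: l H => [|a l IH] H; first by rewrite big_ord1 big_ord0 add0r.
rewrite /= -addnS big_split_ord /= [in RHS]big_ord_recl /= -addrA; congr (_ + _).
  by rewrite -[X in _ *+ X]card_ord -sumr_const; apply: eq_bigr => i _; rewrite ltn_ord.
rewrite -(IH (fun j => H j.+1)); apply: eq_bigr => i _.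
by rewrite ltnNge leq_addr /= addKn.
Qed.

(** Stated as a balance without subtraction, so that it serves both for real second moments and for
    counts in [nat]. *)
Lemma incr_nth_sum {V : nmodType} (G : nat -> nat -> V) (l : seq nat) i :
  (i <= size l)%N -> (forall j, G j 0%N = 0) ->
  \sum_(j < size (incr_nth l i)) G j (nth 0%N (incr_nth l i) j) + G i (nth 0%N l i) =
  \sum_(j < size l) G j (nth 0%N l j) + G i (nth 0%N l i).+1.
Proof.
move=> il G0; rewrite size_incr_nth; case: ltnP => il'.
  rewrite (bigD1 (Ordinal il')) //= [in RHS](bigD1 (Ordinal il')) //=.
  rewrite nth_incr_nth eqxx add1n -addrA addrC.
  rewrite -!addrA [in LHS]addrC -!addrA; congr (_ + _); rewrite addrC; congr (_ + _).
  apply: eq_bigr => j ji; rewrite nth_incr_nth.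
  by case: eqP => // ij; case/eqP: ji; apply: val_inj.
have -> : i = size l by apply/eqP; rewrite eqn_leq il il'.
rewrite big_ord_recr /= nth_incr_nth eqxx nth_default// G0 addr0 addn0; congr (_ + _).
by apply: eq_bigr => j _; rewrite nth_incr_nth gtn_eqF.
Qed.

Lemma sumn_incr_nth l i : sumn (incr_nth l i) = (sumn l).+1.
Proof.
elim: l i => [|a l IH] [|i] //=; first by rewrite sumn_ncons mul0n.
by rewrite IH addnS.
Qed.

Lemma tables_size_sumn ds : sumn (tables ds) = size ds.
Proof.
by elim: ds => //= i ds <-; exact: sumn_incr_nth.
Qed.

Lemma tables_drop_size k ds :
  (size (tables (drop k ds)) <= size (tables ds))%N.
Proof.
elim: ds k => [|i ds IH] [|k] //=; apply: leq_trans (IH k) _.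
by rewrite size_incr_nth; case: ltnP => // h; apply: leq_trans h _; exact: leqW.
Qed.

Section restaurant.
Context {R : realType}.

(** One step of the restaurant, given the past. [F] also receives the earlier digits, because
    two-time quantities still refer to [drop k] of them. *)
Lemma fexp_digits_tables n (F : seq nat -> seq nat -> R) :
  fexp (digits n.+1) (fun ds => F (behead ds) (tables ds)) =
  fexp (digits n) (fun ds => let l := tables ds in
    n.+1%:R^-1 * (\sum_(j < size l) (nth 0%N l j)%:R * F ds (incr_nth l j) +
                  F ds (incr_nth l (size l)))).
Proof.
rewrite fexp_digitsS; apply: eq_fexp_in => x /digits_size xn.
have {xn}nE : n = sumn (tables x.2) by rewrite tables_size_sumn.
subst n => /=; congr (_ * _).
rewrite (sum_table _ (fun j => F x.2 (incr_nth (tables x.2) j))); congr (_ + _).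
by apply: eq_bigr => j _; rewrite mulr_natl.
Qed.

Lemma fexp_digits_drop k n (F : seq nat -> R) :
  fexp (digits (k + n)) (fun ds => F (drop k ds)) = fexp (digits n) F.
Proof.
elim: k => [|k IH]; first by apply: eq_fexp => ds; rewrite drop0.
rewrite addSn fexp_digitsS -IH; apply: eq_fexp => ds /=.
by rewrite sumr_const card_ord -[F _ *+ _]mulr_natl mulrA mulVf ?mul1r// pnatr_eq0.
Qed.

(** For [l] an earlier state of [l'], tables opened in between contribute nothing, since [nth]
    defaults to 0. *)
Definition cross (l' l : seq nat) : R :=
  \sum_(j < size l') (nth 0%N l' j)%:R * (nth 0%N l j)%:R.

Lemma cross_sumn l : \sum_(j < size l) (nth 0%N l j)%:R = (sumn l)%:R :> R.
Proof. by rewrite sumnE (big_nth 0%N) big_mkord natr_sum. Qed.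

(** Joining a table of size [a] adds [2a + 1] to the sum of squares and happens with probability
    [a / (n + 1)]. This gives the recursion with factor [(n + 3) / (n + 1)] and increment 1. *)
Lemma fexp_cross_self n :
  fexp (digits n) (fun ds => cross (tables ds) (tables ds)) = n%:R * n.+1%:R / 2.
Proof.
elim: n => [|n IH]; first by rewrite fexp_digits0 /cross big_ord0; lra.
rewrite (fexp_digits_tables n (fun _ l => cross l l)) /=.
rewrite (@eq_fexp_in _ _ _ _ (fun ds => (n.+3%:R / n.+1%:R) *
  cross (tables ds) (tables ds) + 1)).
  rewrite fexpD fexpZ IH fexp_cst; last exact: fdist_digits.
  by rewrite -[n.+3%:R]natr1 -[n.+2%:R]natr1 -[n.+1%:R]natr1; field; rewrite ?natr1 ?nat1r pnatr_eq0.
move=> x /digits_size xn; set l := tables x.2.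
have incrE j : (j <= size l)%N ->
    cross (incr_nth l j) (incr_nth l j) = cross l l + (2 * (nth 0%N l j)%:R + 1).
  move=> jl; have := @incr_nth_sum R (fun _ a => a%:R * a%:R) l j jl (fun=> mulr0 _).
  rewrite -[(_.+1)%:R in X in _ = X]natr1 => /(canRL (addrK _)).
  by rewrite /cross => ->; lra.
rewrite incrE// nth_default// mulr0 add0r.
have -> : \sum_(j < size l) (nth 0%N l j)%:R * cross (incr_nth l j) (incr_nth l j) =
    n%:R * cross l l + 2 * cross l l + n%:R.
  rewrite {1 2}(_ : n%:R = \sum_(j < size l) (nth 0%N l j)%:R :> R); last first.
    by rewrite cross_sumn tables_size_sumn xn.
  rewrite mulr_suml [X in _ + 2 * X]/cross mulr_sumr.
  rewrite -!big_split /=; apply: eq_bigr => j _.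
  by rewrite incrE; [ring|exact/ltnW/ltn_ord].
rewrite -[n.+3%:R]natr1 -[n.+2%:R]natr1 -[n.+1%:R]natr1.
by field; rewrite ?natr1 ?nat1r pnatr_eq0.
Qed.

(* Once opened, a table of size [l_j] at time [n] is such that [l_j / (n + 1)]
   is a martingale. *)
Lemma fexp_cross_drop k n :
  fexp (digits (k + n)) (fun ds => cross (tables ds) (tables (drop k ds))) =
  n%:R * (k + n).+1%:R / 2.
Proof.
elim: k => [|k IH].
  by rewrite -fexp_cross_self; apply: eq_fexp => ds; rewrite drop0.
rewrite addSn.
rewrite (@eq_fexp_in _ _ _ _ (fun ds => cross (tables ds) (tables (drop k (behead ds))))).
  2: by move=> x /digits_size; case: x => w [].
rewrite (fexp_digits_tables (k + n) (fun ds l => cross l (tables (drop k ds)))) /=.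
set m := (k + n)%N in IH *.
rewrite (@eq_fexp_in _ _ _ _ (fun ds => (m.+2%:R / m.+1%:R) *
  cross (tables ds) (tables (drop k ds)))).
  rewrite fexpZ IH.
  by rewrite -[m.+2%:R]natr1 -[m.+1%:R]natr1; field; rewrite ?natr1 ?nat1r pnatr_eq0.
move=> x /digits_size xn; set l := tables x.2; set l0 := tables _.
have incrE j : (j <= size l)%N ->
    cross (incr_nth l j) l0 = cross l l0 + (nth 0%N l0 j)%:R.
  move=> jl.
  have := @incr_nth_sum R (fun i a => a%:R * (nth 0%N l0 i)%:R) l j jl (fun=> mul0r _).
  rewrite -[(_.+1)%:R in X in _ = X]natr1 => /(canRL (addrK _)).
  by rewrite /cross => ->; lra.
rewrite incrE// [nth 0%N l0 _]nth_default ?tables_drop_size// addr0.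
have -> : \sum_(j < size l) (nth 0%N l j)%:R * cross (incr_nth l j) l0 =
    m%:R * cross l l0 + cross l l0.
  rewrite (_ : m%:R = \sum_(j < size l) (nth 0%N l j)%:R :> R); last first.
    by rewrite cross_sumn tables_size_sumn xn.
  rewrite mulr_suml [X in _ + X]/cross.
  rewrite -!big_split /=; apply: eq_bigr => j _.
  by rewrite incrE; [ring|exact/ltnW/ltn_ord].
by rewrite -[m.+2%:R]natr1 -[m.+1%:R]natr1; field; rewrite ?natr1 ?nat1r pnatr_eq0.
Qed.

(** Expanding the square, with [m = k + n], the three second moments contribute [(m + 1) / (2m)],
    [-(m + 1) / m] and [(n + 1) / (2n)]. *)
Lemma fexp_sqdist k n : (0 < n)%N ->
  fexp (digits (R:=R) (k + n)) (fun ds => let l' := tables ds in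
    let l := tables (drop k ds) in
    \sum_(j < size l') ((nth 0%N l' j)%:R / (k + n)%:R - (nth 0%N l j)%:R / n%:R) ^+ 2)
  = (n%:R^-1 - (k + n)%:R^-1) / 2.
Proof.
move=> n0; have m0 : (0 < k + n)%N by rewrite ltn_addl.
set m := (k + n)%N in m0 *.
transitivity (fexp (digits m) (fun ds => m%:R ^- 2 * cross (tables ds) (tables ds)
   - (2 / (m%:R * n%:R)) * cross (tables ds) (tables (drop k ds))
   + n%:R ^- 2 * cross (tables (drop k ds)) (tables (drop k ds)))).
  apply: eq_fexp => ds /=; set l' := tables ds; set l := tables (drop k ds).
  have -> : cross l l = \sum_(j < size l') (nth 0%N l j)%:R * (nth 0%N l j)%:R.
    rewrite /cross -(big_mkord xpredT (fun j => (nth 0%N l j)%:R * (nth 0%N l j)%:R)).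
    rewrite -[RHS](big_mkord xpredT (fun j => (nth 0%N l j)%:R * (nth 0%N l j)%:R)).
    rewrite [RHS](big_cat_nat (n := size l)) ?tables_drop_size//=.
    rewrite [X in _ = _ + X]big_nat [X in _ = _ + X]big1 ?addr0// => j /andP[lj _].
    by rewrite nth_default ?mul0r.
  rewrite /cross !mulr_sumr -sumrB -big_split /=; apply: eq_bigr => j _.
  by field; rewrite !pnatr_eq0 -!lt0n n0 m0.
rewrite fexpD fexpB !fexpZ fexp_cross_self fexp_cross_drop.
rewrite (fexp_digits_drop k n (fun ds => cross (tables ds) (tables ds))).
rewrite fexp_cross_self -/m -[m.+1%:R]natr1 -[n.+1%:R]natr1.
by field; rewrite !pnatr_eq0 -!lt0n n0 m0.
Qed.

End restaurant.

(** * The three-colour urn *)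

(** The number of customers whose table has a colour in [pi]. *)
Definition cnt {K : Type} (k0 : K) (pi : pred K) (l : seq nat) (s : seq K) : nat :=
  (\sum_(j < size l) nth 0%N l j * pi (nth k0 s j))%N.

Lemma cnt_incr_nth {K : Type} (k0 : K) (pi : pred K) l (s : seq K) j :
  (j <= size l)%N -> cnt k0 pi (incr_nth l j) s = (cnt k0 pi l s + pi (nth k0 s j))%N.
Proof.
move=> jl; have := @incr_nth_sum nat (fun i a => a * pi (nth k0 s i))%N l j jl
  (fun=> mul0n _).
rewrite -/(cnt k0 pi l s) -/(cnt k0 pi (incr_nth l j) s) mulSn.
by move: (cnt _ _ _ _) (cnt _ _ _ _) (nth _ _ _ * _)%N => u v w /=; lia.
Qed.

Lemma cnt_nil {K : Type} (k0 : K) (pi : pred K) s : cnt k0 pi [::] s = 0%N.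
Proof. exact: big_ord0. Qed.

Lemma cnt_rcons {K : Type} (k0 : K) (pi : pred K) l (s : seq K) k :
  (size l <= size s)%N -> cnt k0 pi l (rcons s k) = cnt k0 pi l s.
Proof.
move=> ls; apply: eq_bigr => j _; rewrite nth_rcons.
by rewrite (leq_trans (ltn_ord j) ls).
Qed.

Lemma cnt_le {K : Type} (k0 : K) (pi : pred K) l (s : seq K) :
  (cnt k0 pi l s <= sumn l)%N.
Proof.
rewrite sumnE (big_nth 0%N) big_mkord; apply: leq_sum => j _.
by case: (pi _); rewrite ?muln1 ?muln0.
Qed.

Section weight.
Context {R : realType}.
Implicit Type x : R.

(** The coefficient of [z^a] in [(1 - z)^(-x)], that is, the rising factorial of [x] divided by
    [a!]. *)
Definition weight x a : R := \prod_(j < a) ((x + j%:R) / j.+1%:R).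

Lemma weightS x a : weight x a.+1 * a.+1%:R = (x + a%:R) * weight x a.
Proof.
rewrite /weight big_ord_recr /= -mulrA divfK ?pnatr_eq0//.
by rewrite mulrC.
Qed.

Lemma weight_ge0 x a : 0 <= x -> 0 <= weight x a.
Proof. by move=> x0; apply: prodr_ge0 => j _; rewrite divr_ge0 ?addr_ge0. Qed.

(* The ratio [weight x a.+1 / weight x a = 1 - (1 - x) / (a + 1)] increases. *)
Lemma weight_logconvex x a b : 0 < x <= 1 -> (a <= b)%N ->
  weight x a.+1 * weight x b <= weight x a * weight x b.+1.
Proof.
move=> /andP[x0 x1] ab; have := weightS x a; have := weightS x b.
set wa := weight x a; set wb := weight x b => eb ea.
have wa0 : 0 <= wa by rewrite weight_ge0 ?ltW.
have wb0 : 0 <= wb by rewrite weight_ge0 ?ltW.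
rewrite -(ler_pM2r (_ : 0 < a.+1%:R * b.+1%:R :> R)); last by rewrite mulr_gt0.
rewrite [leLHS](_ : _ = (weight x a.+1 * a.+1%:R) * (wb * b.+1%:R)); last by ring.
rewrite [leRHS](_ : _ = (weight x b.+1 * b.+1%:R) * (wa * a.+1%:R)); last by ring.
rewrite ea eb -!natr1.
have ab' : a%:R <= b%:R :> R by rewrite ler_nat.
rewrite -subr_ge0 (_ : _ - _ = wa * wb * ((1 - x) * (b%:R - a%:R))); last by ring.
by rewrite mulr_ge0 ?mulr_ge0// subr_ge0.
Qed.

(** [k] applications of log-convexity, each moving one unit from the smaller argument to the
    larger. *)
Lemma weight_spread x a b k : 0 < x <= 1 -> (a + k <= b)%N ->
  weight x (a + k) * weight x b <= weight x a * weight x (b + k).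
Proof.
move=> x01; elim: k a b => [|k IH] a b akb; first by rewrite !addn0.
apply: (@le_trans _ _ (weight x (a + k) * weight x b.+1)).
  by rewrite addnS weight_logconvex//; lia.
by rewrite addnS -addSn IH//; lia.
Qed.

End weight.

Section urn.
Context {R : realType} (p : R).
Hypothesis p01 : 0 < p < 1.

Definition bern : seq (R * bool) := [:: (p, true); (1 - p, false)].

Definition bern2 : seq (R * (bool * bool)) := fpair pair bern bern.

Lemma fdist_bern : fdist bern.
Proof.
split; last by rewrite !big_cons big_nil /=; lra.
by rewrite /=; move: p01 => /andP[? ?]; rewrite subr_ge0 !ltW.
Qed.

Lemma fdist_bern2 : fdist bern2.
Proof. by apply: fdist_fpair; exact: fdist_bern. Qed.

(** The two components of a colour tell which of two independent copies contain the cycle. *)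
Definition only1 (k : bool * bool) := k.1 && ~~ k.2.
Definition only2 (k : bool * bool) := ~~ k.1 && k.2.
Definition agree (k : bool * bool) := k.1 == k.2.

Definition urn (F : nat -> nat -> nat -> R) (l : seq nat) (s : seq (bool * bool)) :=
  F (cnt (false, false) only1 l s) (cnt (false, false) only2 l s)
    (cnt (false, false) agree l s).

Definition annealed n F : R :=
  fexp (digits n) (fun ds =>
    fexp (colourings bern2 (size (tables ds))) (urn F (tables ds))).

(** [q] is the probability that a cycle lies in the first copy only, and likewise in the second
    only; [y], which equals [p^2 + (1 - p)^2], is the probability that the copies agree on it. *)
Let q := p * (1 - p).
Let y := 1 - 2 * q.

Lemma cnt_partition l s : (cnt (false, false) only1 l s +
  cnt (false, false) only2 l s + cnt (false, false) agree l s)%N = sumn l.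
Proof.
rewrite /cnt -!big_split /= sumnE (big_nth 0%N) big_mkord; apply: eq_bigr => j _.
by rewrite -!mulnDr; case: (nth (false, false) s j) => [[] []] /=; rewrite muln1.
Qed.

Lemma annealed0 F : annealed 0 F = F 0%N 0%N 0%N.
Proof. by rewrite /annealed fexp_digits0 fexp_colouring0 /urn !cnt_nil. Qed.

(** The Polya urn with initial weights [q], [q], [y]: a customer joining a table reinforces its
    colour, and one opening a table draws a fresh colour. *)
Lemma annealedS n F : annealed n.+1 F = annealed n (fun a b c =>
  n.+1%:R^-1 * ((a%:R + q) * F a.+1 b c + (b%:R + q) * F a b.+1 c
               + (c%:R + y) * F a b c.+1)).
Proof.
rewrite /annealed (fexp_digits_tables n (fun _ l => fexp (colourings bern2 (size l)) (urn F l))).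
apply: eq_fexp_in => x /digits_size xn /=; set l := tables x.2.
rewrite [in LHS]size_incr_nth ltnn fexp_colouringS fexpZ; congr (_ * _).
under eq_bigr => j _.
  rewrite size_incr_nth ltn_ord -fexpZ.
  over.
rewrite -fexp_sum -fexpD; apply: eq_fexp_in => -[v s] /colouring_size /= sl.
have -> : fexp bern2 (fun k => urn F (incr_nth l (size l)) (rcons s k)) =
   q * F (cnt (false, false) only1 l s).+1 (cnt (false, false) only2 l s)
    (cnt (false, false) agree l s) +
   q * F (cnt (false, false) only1 l s) (cnt (false, false) only2 l s).+1
    (cnt (false, false) agree l s) +
   y * F (cnt (false, false) only1 l s) (cnt (false, false) only2 l s)
    (cnt (false, false) agree l s).+1.
  rewrite /bern2 fexp_fpair /fexp /urn !big_cons !big_nil /= !addr0.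
  rewrite !cnt_incr_nth// !cnt_rcons ?sl// !nth_rcons sl ltnn eqxx /=.
  by rewrite ?addn0 ?addn1 /y /q; ring.
set A := cnt _ only1 l s; set B := cnt _ only2 l s; set C := cnt _ agree l s.
have -> : \sum_(j < size l) (nth 0%N l j)%:R * urn F (incr_nth l j) s =
    A%:R * F A.+1 B C + B%:R * F A B.+1 C + C%:R * F A B C.+1.
  have cE pi : (cnt (false, false) pi l s)%:R =
      \sum_(j < size l) (nth 0%N l j)%:R * (pi (nth (false, false) s j))%:R :> R.
    by rewrite natr_sum; apply: eq_bigr => j _; rewrite natrM.
  rewrite [A%:R]cE [B%:R]cE [C%:R]cE !mulr_suml -!big_split /=; apply: eq_bigr => j _.
  have jl := ltnW (ltn_ord j).
  rewrite /urn !(cnt_incr_nth _ _ _ jl) -/A -/B -/C.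
  case: (nth (false, false) s j) => [[] []] /=;
    by rewrite ?addn0 ?addn1 ?mulr0 ?mulr1 ?mul0r ?addr0 ?add0r.
by ring.
Qed.

Lemma annealed_le n F G :
  (forall a b c, (a + b + c)%N = n -> F a b c <= G a b c) ->
  annealed n F <= annealed n G.
Proof.
move=> FG; apply: fexp_le_in; first exact: fdist_digits.
move=> x /digits_size xn; apply: fexp_le; first exact/fdist_colourings/fdist_bern2.
by move=> s; apply: FG; rewrite cnt_partition tables_size_sumn.
Qed.

Lemma eq_annealed n F G :
  (forall a b c, (a + b + c)%N = n -> F a b c = G a b c) ->
  annealed n F = annealed n G.
Proof.
by move=> FG; apply/eqP; rewrite eq_le !annealed_le// => a b c /FG ->.
Qed.

Lemma annealedD n F G :
  annealed n (fun a b c => F a b c + G a b c) = annealed n F + annealed n G.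
Proof. by rewrite -fexpD; apply: eq_fexp => ds; rewrite -fexpD. Qed.

Lemma annealedZ n k F :
  annealed n (fun a b c => k * F a b c) = k * annealed n F.
Proof. by rewrite -fexpZ; apply: eq_fexp => ds; rewrite -fexpZ. Qed.

Lemma annealed_sum n I (r : seq I) (P : pred I) F :
  annealed n (fun a b c => \sum_(i <- r | P i) F i a b c) =
  \sum_(i <- r | P i) annealed n (F i).
Proof. by rewrite -fexp_sum; apply: eq_fexp => ds; rewrite -fexp_sum. Qed.

Lemma annealed_cst n k : annealed n (fun _ _ _ => k) = k.
Proof.
rewrite /annealed (@eq_fexp _ _ _ _ (fun=> k)) ?fexp_cst//; first exact: fdist_digits.
by move=> ds; rewrite /urn fexp_cst//; exact/fdist_colourings/fdist_bern2.
Qed.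

Let q_gt0 : 0 < q. Proof. by rewrite /q; move: p01 => /andP[? ?]; nra. Qed.
Let q_le : q <= 4^-1. Proof. by rewrite /q; have := sqr_ge0 (p - 1 / 2); nra. Qed.
Let y_gt0 : 0 < y. Proof. by rewrite /y; have := q_le; lra. Qed.

Definition diracf a b c : nat -> nat -> nat -> R :=
  fun a' b' c' => [&& a' == a, b' == b & c' == c]%:R.

(** The Dirichlet-multinomial law. The last customer has one of the three colours, and [weightS]
    turns the three terms of the urn step into [a], [b] and [c] times the claimed product; they add
    up to [n + 1] times it. *)
Lemma annealed_law n a b c : (a + b + c)%N = n ->
  annealed n (diracf a b c) = weight q a * weight q b * weight y c.
Proof.
elim: n a b c => [|n IH] a b c.
  case: a => //; case: b => //; case: c => // _.
  by rewrite annealed0 /diracf /weight !big_ord0 !mulr1.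
move=> abc; rewrite annealedS annealedZ.
have e1 : annealed n (fun a' b' c' => (a'%:R + q) * diracf a b c a'.+1 b' c') =
    a%:R * (weight q a * weight q b * weight y c).
  case: a abc => [|a] abc.
    rewrite mul0r (@eq_annealed _ _ (fun _ _ _ => 0)) ?annealed_cst// => *.
    by rewrite /diracf /= mulr0.
  rewrite (@eq_annealed _ _ (fun a' b' c' => (a%:R + q) * diracf a b c a' b' c')).
    rewrite annealedZ IH; last by move: abc; rewrite !addSn => -[].
    by rewrite !mulrA [a%:R + q]addrC -weightS; ring.
  move=> a' b' c' _; rewrite /diracf eqSS.
  by case: (eqVneq a' a) => [->//|_]; rewrite !mulr0.
have e2 : annealed n (fun a' b' c' => (b'%:R + q) * diracf a b c a' b'.+1 c') =
    b%:R * (weight q a * weight q b * weight y c).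
  case: b abc {e1} => [|b] abc.
    rewrite mul0r (@eq_annealed _ _ (fun _ _ _ => 0)) ?annealed_cst// => *.
    by rewrite /diracf /= andbF mulr0.
  rewrite (@eq_annealed _ _ (fun a' b' c' => (b%:R + q) * diracf a b c a' b' c')).
    rewrite annealedZ IH; last by move: abc; rewrite !addnS !addSn => -[].
    transitivity (((q + b%:R) * weight q b) * weight q a * weight y c); first by ring.
    by rewrite -weightS; ring.
  move=> a' b' c' _; rewrite /diracf eqSS.
  by case: (eqVneq b' b) => [->//|_]; rewrite /= andbF !mulr0.
have e3 : annealed n (fun a' b' c' => (c'%:R + y) * diracf a b c a' b' c'.+1) =
    c%:R * (weight q a * weight q b * weight y c).
  case: c abc {e1 e2} => [|c] abc.
    rewrite mul0r (@eq_annealed _ _ (fun _ _ _ => 0)) ?annealed_cst// => *.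
    by rewrite /diracf /= !andbF mulr0.
  rewrite (@eq_annealed _ _ (fun a' b' c' => (c%:R + y) * diracf a b c a' b' c')).
    rewrite annealedZ IH; last by move: abc; rewrite !addnS => -[].
    transitivity (((y + c%:R) * weight y c) * weight q a * weight q b); first by ring.
    by rewrite -weightS; ring.
  move=> a' b' c' _; rewrite /diracf eqSS.
  by case: (eqVneq c' c) => [->//|_]; rewrite /= !andbF !mulr0.
by rewrite !annealedD e1 e2 e3 -!mulrDl -!natrD abc mulrA mulVf ?mul1r.
Qed.

End urn.

(** * Anti-concentration of the urn *)

(** The average over [W] is at most the overall average: in the double sum of [g b - g a] with [a]
    in [W], the pairs inside [W] cancel and the others are nonnegative. *)
Lemma sum_low_part {R : realFieldType} {I : finType} (W : pred I) (g : I -> R) :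
  (forall a b, W a -> ~~ W b -> g a <= g b) ->
  #|I|%:R * \sum_(a | W a) g a <= #|W|%:R * \sum_a g a.
Proof.
move=> Wg; rewrite -subr_ge0.
have -> : #|W|%:R * \sum_a g a - #|I|%:R * \sum_(a | W a) g a =
    \sum_(a | W a) \sum_b (g b - g a).
  under [RHS]eq_bigr => a _ do rewrite sumrB sumr_const -mulr_natl.
  rewrite sumrB sumr_const -[X in _ = X - _]mulr_natl -[X in _ = _ - X]mulr_sumr.
  by congr (_ - _%:R * _); exact: eq_card.
have -> : \sum_(a | W a) \sum_b (g b - g a) =
    \sum_(a | W a) \sum_(b | ~~ W b) (g b - g a).
  under eq_bigr => a _ do rewrite (bigID W) /=.
  rewrite big_split /= [X in X + _](_ : _ = 0) ?add0r//.
  under eq_bigr => a _ do rewrite sumrB.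
  by rewrite sumrB exchange_big subrr.
by apply: sumr_ge0 => a Wa; apply: sumr_ge0 => b Wb; rewrite subr_ge0 Wg.
Qed.

Definition near_diag (L a b : nat) : bool := (a <= b + L)%N && (b <= a + L)%N.

Section concentration.
Context {R : realType}.

Lemma weight_far (q : R) L a b a' b' : 0 < q <= 1 -> (a + b = a' + b')%N ->
  near_diag L a b -> ~~ near_diag L a' b' ->
  weight q a * weight q b <= weight q a' * weight q b'.
Proof.
move=> q01.
have key c d c' d' : (c + d = c' + d')%N -> (c' <= c)%N -> (c <= d)%N ->
    weight q c * weight q d <= weight q c' * weight q d'.
  move=> cd c'c cd'; have -> : c = (c' + (c - c'))%N by lia.
  have -> : d' = (d + (c - c'))%N by lia.
  by apply: weight_spread => //; lia.
rewrite /near_diag => e ab a'b'.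
have [ab0|ba0] := leqP a b; have [ab1|ba1] := leqP a' b'.
- by apply: key => //; lia.
- by rewrite [leRHS]mulrC; apply: key => //; lia.
- by rewrite mulrC; apply: key => //; lia.
- by rewrite mulrC [leRHS]mulrC; apply: key => //; lia.
Qed.

Lemma card_near_diag L N :
  (#|[pred a : 'I_N.+1 | near_diag L a (N - a)]| <= L.+1)%N.
Proof.
(* Nearness to the diagonal reads [|2a - N| <= L], so [a] starts at the ceiling of [(N - L) / 2] and
   takes at most [L + 1] values. *)
pose lo := ((N - L).+1 %/ 2)%N.
have sub : {subset [seq val a | a <- enum [pred a : 'I_N.+1 | near_diag L a (N - a)]]
    <= iota lo L.+1}.
  move=> _ /mapP[a + ->]; rewrite mem_enum inE /near_diag => /andP[h1 h2].
  by rewrite mem_iota; have := ltn_ord a; rewrite /lo /=; lia.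
have := uniq_leq_size _ sub; rewrite size_map size_iota -cardE; apply.
by rewrite map_inj_uniq ?enum_uniq//; exact: val_inj.
Qed.

Lemma weight_near_diag (q : R) L N : 0 < q <= 1 ->
  N.+1%:R * \sum_(a < N.+1 | near_diag L a (N - a)) weight q a * weight q (N - a)
  <= L.+1%:R * \sum_(a < N.+1) weight q a * weight q (N - a).
Proof.
move=> q01; have q0 : 0 <= q by case/andP: q01 => /ltW.
have := @sum_low_part R 'I_N.+1 (fun a => near_diag L a (N - a))
  (fun a => weight q a * weight q (N - a)).
rewrite card_ord => h; apply: le_trans (h _) _ => {h}.
  by move=> a b; apply: weight_far => //; have := ltn_ord a; have := ltn_ord b; lia.
rewrite ler_wpM2r ?ler_nat ?card_near_diag//.
by apply: sumr_ge0 => a _; rewrite mulr_ge0 ?weight_ge0.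
Qed.

Lemma subn_le_norm a b : (a - b)%:R <= `|a%:R - b%:R| :> R.
Proof.
have [ab|/ltnW ab] := leqP a b; last by rewrite natrB// ler_norm.
by move: ab; rewrite -subn_eq0 => /eqP ->; exact: normr_ge0.
Qed.

Definition rising (x : R) r : R := \prod_(i < r) (x + i%:R).

Lemma rising_shift x r : x * rising (x + 1) r = rising x r * (x + r%:R).
Proof.
transitivity (rising x r.+1); last by rewrite /rising big_ord_recr.
rewrite /rising big_ord_recl addr0; congr (_ * _); apply: eq_bigr => i _.
by rewrite /= /bump /= natrD addrA.
Qed.

Lemma rising_gt0 x r : 0 < x -> 0 < rising x r.
Proof. by move=> x0; apply: prodr_gt0 => i _; rewrite ltr_wpDr. Qed.

Lemma weight_rising x r : rising x r = weight x r * rising 1 r.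
Proof.
rewrite -big_split /=; apply: eq_bigr => i _.
by rewrite nat1r divfK// pnatr_eq0.
Qed.

Lemma bernoulli_ineq (d : R) r : 0 <= d <= 1 -> 1 - r%:R * d <= (1 - d) ^+ r.
Proof.
move=> /andP[d0 d1]; elim: r => [|r IH]; first by rewrite mul0r subr0 expr0.
rewrite exprS -natr1; apply: (@le_trans _ _ ((1 - d) * (1 - r%:R * d))).
  by have : 0 <= r%:R :> R by []; nra.
by rewrite ler_wpM2l// subr_ge0.
Qed.

(** [weight y r] is the product of the factors [1 - x / (j + 1)] with [x = 1 - y]. The induction
    rests on [(1 - x u) (1 + x S + x u) <= 1 + x S]. The divergence of the harmonic series then
    sends the weight to 0. *)
Lemma weight_harmonic_le (y : R) r : 0 < y <= 1 ->
  weight y r * (1 + (1 - y) * \sum_(i < r) i.+1%:R^-1) <= 1.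
Proof.
move=> /andP[y0 y1]; elim: r => [|r]; first by rewrite /weight !big_ord0 mulr0 addr0 mulr1.
apply: le_trans; rewrite /weight big_ord_recr -/(weight y r) [X in 1 + _ * X]big_ord_recr /=.
set S := \sum_(i < r) _; rewrite -mulrA; apply: ler_wpM2l; first by rewrite weight_ge0 ?ltW.
have S0 : 0 <= S by apply: sumr_ge0 => i _; rewrite invr_ge0.
have r0 : 0 < r.+1%:R^-1 :> R by rewrite invr_gt0.
have -> : y + r%:R = r.+1%:R - (1 - y) by rewrite -natr1; lra.
rewrite mulrBl divff ?pnatr_eq0//.
set u := r.+1%:R^-1 in r0 *; have := mulr_ge0 (_ : 0 <= 1 - y) (ltW r0).
rewrite subr_ge0 => /(_ y1) => xu0; have := mulr_ge0 xu0 xu0.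
have : 0 <= (1 - y) * u * ((1 - y) * S) by rewrite (mulr_ge0 xu0)// mulr_ge0// subr_ge0.
by set x := 1 - y in xu0 *; nra.
Qed.

Lemma weight_small (y e : R) : 0 < y < 1 -> 0 < e ->
  exists2 r, (0 < r)%N & weight y r <= e.
Proof.
move=> /andP[y0 y1] e0.
have : (series (harmonic : R ^nat)) @ \oo --> +oo.
  apply: nondecreasing_dvgn_lt; last exact: dvg_harmonic.
  by apply: nondecreasing_series => n _ _; exact: harmonic_ge0.
move=> /cvgryPge/(_ (e^-1 / (1 - y))) [N _ /(_ N.+1 (leqnSn N))/=].
rewrite /series /= /harmonic big_mkord => h; exists N.+1 => //.
have := @weight_harmonic_le y N.+1; rewrite y0 ltW// => /(_ isT).
set S := \sum_(i < N.+1) _ in h *.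
rewrite ler_pdivrMr ?subr_gt0// in h.
have w0 : 0 <= weight y N.+1 by rewrite weight_ge0 ?ltW.
move=> hw; rewrite -[e]invrK -[leRHS]mul1r ler_pdivlMr ?invr_gt0//.
apply: le_trans hw; apply: ler_wpM2l => //; lra.
Qed.

Variable p : R.
Hypothesis p01 : 0 < p < 1.
Let q := p * (1 - p).
Let y := 1 - 2 * q.

Let q_gt0 : 0 < q. Proof. by rewrite /q; move: p01 => /andP[? ?]; nra. Qed.
Let q_le : q <= 4^-1. Proof. by rewrite /q; have := sqr_ge0 (p - 1 / 2); nra. Qed.
Let y_gt0 : 0 < y. Proof. by rewrite /y; have := q_le; lra. Qed.
Let y_lt1 : y < 1. Proof. by rewrite /y; have := q_gt0; lra. Qed.

(** [F] is decomposed into point masses on the triples of sum [n], indexed by [N = a + b] and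
    [a]. *)
Lemma annealedE n (F : nat -> nat -> nat -> R) : annealed p n F =
  \sum_(N < n.+1) \sum_(a < N.+1) F a (N - a)%N (n - N)%N *
    (weight q a * weight q (N - a) * weight y (n - N)).
Proof.
rewrite (@eq_annealed _ p p01 n _ (fun a b c => \sum_(N < n.+1) \sum_(a' < N.+1)
   F a' (N - a')%N (n - N)%N * diracf a' (N - a')%N (n - N)%N a b c)).
  rewrite annealed_sum; apply: eq_bigr => N _; rewrite annealed_sum.
  apply: eq_bigr => a _; rewrite annealedZ annealed_law//.
  by have := ltn_ord a; have := ltn_ord N; lia.
move=> a b c abc; have abn : (a + b < n.+1)%N by lia.
rewrite (bigD1 (Ordinal abn)) //= [X in _ + X]big1 ?addr0; last first.
  move=> N; rewrite -val_eqE /= => Nab; rewrite big1// => a' _.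
  rewrite /diracf; case: eqP => [e1|]; case: eqP => [e2|]; case: eqP => [e3|];
    rewrite ?mulr0//=.
  by exfalso; move/eqP: Nab; have := ltn_ord a'; have := ltn_ord N; lia.
have aab : (a < (a + b).+1)%N by lia.
rewrite (bigD1 (Ordinal aab)) //= [X in _ + X]big1 ?addr0; last first.
  move=> a'; rewrite -val_eqE /= eq_sym => /negbTE Naa.
  by rewrite /diracf Naa mulr0.
have -> : (a + b - a = b)%N by lia.
have -> : (n - (a + b) = c)%N by lia.
by rewrite /diracf !eqxx mulr1.
Qed.

(** Compared one value of [N = a + b] at a time: for [N > M], the near-diagonal pairs carry at most
    a share [(L + 1) / (N + 1)] of the mass. *)
Lemma annealed_near_diag n L M :
  annealed p n (fun a b _ => (near_diag L a b && (M < a + b)%N)%:R) <=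
  L.+1%:R / M.+1%:R.
Proof.
rewrite annealedE -[leRHS]mulr1.
rewrite -[X in _ * X](annealed_cst p01 n 1) annealedE mulr_sumr.
apply: ler_sum => -[N Nn] _ /=.
have w0 : 0 <= weight y (n - N) by rewrite weight_ge0 ?ltW.
have [NM|MN] := leqP N M.
  rewrite big1; last first.
    move=> a _; rewrite (_ : (M < _)%N = false) ?andbF ?mul0r//.
    by have := ltn_ord a; lia.
  rewrite mulr_ge0 ?divr_ge0// sumr_ge0// => a _.
  by rewrite mul1r !mulr_ge0 ?weight_ge0 ?ltW.
have -> : \sum_(a < N.+1) (near_diag L a (N - a) && (M < a + (N - a))%N)%:R *
    (weight q a * weight q (N - a) * weight y (n - N)) =
    (\sum_(a < N.+1 | near_diag L a (N - a)) weight q a * weight q (N - a)) *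
    weight y (n - N).
  rewrite mulr_suml [RHS]big_mkcond; apply: eq_bigr => a _ /=.
  have -> : (M < a + (N - a))%N by have := ltn_ord a; lia.
  by rewrite andbT; case: ifP; rewrite ?mul1r ?mul0r.
under [X in _ <= _ * X]eq_bigr => a _ do rewrite mul1r.
rewrite -mulr_suml mulrA; apply: ler_wpM2r => //.
rewrite mulrAC ler_pdivlMr// mulrC.
apply: le_trans (weight_near_diag _ _ _); last by have := q_le; have := q_gt0; lra.
rewrite ler_wpM2r ?ler_nat ?leqW//.
by apply: sumr_ge0 => a _; rewrite mulr_ge0 ?weight_ge0 ?ltW.
Qed.

(** The rising factorial of [c + y] is an eigenfunction of the urn step, with multiplier
    [(n + 1 + r) / (n + 1)]. *)
Lemma annealed_rising n r :
  annealed p n (fun _ _ c => rising (c%:R + y) r) = weight y r * rising n.+1%:R r.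
Proof.
elim: n => [|n IH]; first by rewrite annealed0 add0r weight_rising.
rewrite annealedS.
rewrite (@eq_annealed _ p p01 n _ (fun _ _ c =>
    (n.+1%:R + r%:R) / n.+1%:R * rising (c%:R + y) r)).
  rewrite annealedZ IH mulrCA; congr (_ * _).
  have := rising_shift n.+1%:R r; rewrite natr1 => e.
  apply: (@mulfI _ n.+1%:R); first by rewrite pnatr_eq0.
  by rewrite e; field; rewrite ?nat1r ?natr1 pnatr_eq0.
move=> a b c abc; have := rising_shift (c%:R + y) r.
rewrite -/q -/y (_ : c.+1%:R + y = c%:R + y + 1) => [->|]; last by rewrite -natr1; lra.
have yq : y = 1 - 2 * q by [].
have nE : n.+1%:R = a%:R + b%:R + (c%:R + y) + 2 * q :> R.
  by rewrite yq -natr1 -abc !natrD; lra.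
have n0 : n.+1%:R != 0 :> R by rewrite pnatr_eq0.
by rewrite nE in n0 *; field.
Qed.

(** Markov's inequality for the rising factorial of degree [r]. If [a + b <= M] then [c >= n - M],
    so each factor [c + y + i] is at least [(1 - d) (n + 1 + i)] with [d = (M + 1) / (n + 1)]. As
    [r d <= 1/2], Bernoulli's inequality bounds the product below by half of [rising n.+1%:R r]. *)
Lemma annealed_few n M r : (2 * r * M.+1 <= n.+1)%N ->
  annealed p n (fun a b _ => (a + b <= M)%N%:R) <= 2 * weight y r.
Proof.
case: r => [|r] rM.
  rewrite /weight big_ord0 mulr1; apply: (@le_trans _ _ 1); last by lra.
  rewrite -[leRHS](annealed_cst p01 n 1); apply: (annealed_le p01) => a b c _.
  by case: (_ <= _)%N.
have n0 : 0 < n.+1%:R :> R by [].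
have r1 : 0 < rising n.+1%:R r.+1 by exact: rising_gt0.
suff h a b c : (a + b + c)%N = n ->
    (a + b <= M)%N%:R <= 2 / rising n.+1%:R r.+1 * rising (c%:R + y) r.+1.
  apply: le_trans (annealed_le p01 h) _.
  by rewrite annealedZ annealed_rising mulrCA divfK ?gt_eqF// mulrC.
move=> abc; have rc0 : 0 < rising (c%:R + y) r.+1 by apply: rising_gt0; apply: ltr_wpDl.
have [abM|_] := leqP (a + b) M; last by rewrite mulr_ge0 ?divr_ge0// ltW.
pose d : R := M.+1%:R / n.+1%:R.
have Mn : (M.+1 <= n.+1)%N by apply: leq_trans rM; rewrite leq_pmull.
have d01 : 0 <= d <= 1.
  by rewrite divr_ge0//= ler_pdivrMr// mul1r ler_nat.
have rd : r.+1%:R * d <= 2^-1.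
  rewrite /d mulrA ler_pdivrMr//.
  by move: rM; rewrite -(ler_nat R) !natrM; lra.
have : (1 - d) ^+ r.+1 * rising n.+1%:R r.+1 <= rising (c%:R + y) r.+1.
  rewrite /rising -[X in _ ^+ X]card_ord -prodr_const -big_split /=.
  apply: ler_prod => i _; apply/andP; split.
    by case/andP: d01 => ? ?; rewrite mulr_ge0 ?subr_ge0// addr_ge0.
  have cM : n.+1%:R - M.+1%:R <= c%:R :> R.
    by rewrite lerBlDr -natrD ler_nat; move: abc abM; clear; lia.
  have dn : d * n.+1%:R = M.+1%:R by rewrite /d divfK.
  have : 0 <= d * i%:R by case/andP: d01 => ? ?; rewrite mulr_ge0.
  by have := y_gt0; nra.
have := bernoulli_ineq r.+1 d01.
move=> h1 h2; rewrite mulrAC ler_pdivlMr// mul1r.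
set P := rising n.+1%:R _ in r1 h2 *; nra.
Qed.

Lemma annealed_concentration (e : R) : 0 < e -> exists2 h : R, 0 < h &
  exists n0, forall n, (n0 <= n)%N ->
    annealed p n (fun a b _ => (`|a%:R - b%:R| <= h * n%:R :> R)%:R) <= e.
Proof.
move=> e0; have y01 : 0 < y < 1 by rewrite y_gt0 y_lt1.
have e40 : 0 < e / 4 by rewrite divr_gt0.
have [r r0 wr] := weight_small y01 e40.
have rR : 0 < r%:R :> R by rewrite ltr0n.
(* Half of [e] pays for a small [a + b], through [2 weight y r <= e / 2]. The other half pays for
   the diagonal: both [h n] and the rounding 1 in [L + 1 <= h n + 1] stay below [e / 4] times
   [M + 1]. *)
pose h := e / (16 * r%:R).
have h0 : 0 < h by rewrite divr_gt0// mulr_gt0.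
exists h => //; exists (4 * r + Num.truncn (16 * r%:R / e))%N.
move=> n nn0.
have n4 : (4 * r <= n.+1)%N.
  by move: nn0; clear; move: (Num.truncn _) => T; lia.
have n16 : 16 * r%:R <= e * n.+1%:R.
  rewrite [leRHS]mulrC -ler_pdivrMr//; apply: ltW; apply: lt_le_trans (truncnS_gt _) _.
  by rewrite ler_nat; move: nn0; clear; move: (Num.truncn _) => T; lia.
(* The largest [M] that [annealed_few] admits. *)
pose M := (n.+1 %/ (2 * r)).-1.
have Md : (n.+1 %/ (2 * r) = M.+1)%N.
  by rewrite prednK// divn_gt0; move: n4 r0; clear; lia.
have rM : (2 * r * M.+1 <= n.+1)%N by rewrite -Md mulnC leq_divM.
have nM : (n.+1 <= 4 * r * M.+1)%N.
  have := divn_eq n.+1 (2 * r); have := @ltn_pmod n.+1 (2 * r); rewrite Md; move: r0; clear; nia.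
pose L := Num.truncn (h * n%:R).
apply: (@le_trans _ _ (annealed p n (fun a b _ =>
   (near_diag L a b && (M < a + b)%N)%:R + (a + b <= M)%N%:R))).
  apply: (annealed_le p01) => a b c _.
  have [abM|abM] := leqP (a + b) M; first by rewrite andbF add0r ler_nat; case: (`|_| <= _).
  rewrite andbT addr0.
  case: (boolP (`|_| <= _)) => // abh; suff -> : near_diag L a b by [].
  have hn0 : 0 <= h * n%:R by rewrite mulr_ge0// ltW.
  rewrite /near_diag -!leq_subLR /L.
  rewrite !truncn_ge_nat//; apply/andP; split; apply: le_trans abh.
    exact: subn_le_norm.
  by rewrite distrC; exact: subn_le_norm.
rewrite annealedD; have := annealed_near_diag n L M; have := annealed_few rM.
move=> few near.
suff LM : L.+1%:R / M.+1%:R <= e / 2.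
  have few' := le_trans few (ler_wpM2l (ler0n R 2) wr).
  by apply: le_trans (lerD (le_trans near LM) few') _; lra.
rewrite ler_pdivrMr//.
have LE : L.+1%:R <= h * n%:R + 1.
  by rewrite -natr1 lerD2r truncn_le// mulr_ge0// ltW.
have nMR : n.+1%:R <= 4 * r%:R * M.+1%:R :> R by rewrite -!natrM ler_nat.
apply: le_trans LE _.
have hr : h * (16 * r%:R) = e by rewrite /h divfK// mulf_neq0 ?gt_eqF.
have : h * n%:R <= e / 4 * M.+1%:R.
  apply: (@le_trans _ _ (h * (4 * r%:R * M.+1%:R))); last by rewrite -hr; lra.
  by rewrite ler_pM2l// (le_trans _ nMR)// ler_nat.
suff : 1 <= e / 4 * M.+1%:R by lra.
rewrite -(ler_pM2l (_ : 0 < 16 * r%:R)) ?mulr_gt0// mulr1.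
apply: le_trans n16 _; apply: (@le_trans _ _ (e * (4 * r%:R * M.+1%:R))); last by lra.
by rewrite ler_pM2l.
Qed.

End concentration.

(** * Estimates given the table sizes *)

Section quenched.
Context {R : realType} (p : R).
Hypothesis p01 : 0 < p < 1.

Definition csum (l : seq nat) (b : seq bool) : nat := cnt false id l b.

(** The process at [t] when the cycle lengths are [l], as [process_fun_cdf] shows. *)
Definition cdf (l : seq nat) (t : R) : R :=
  fexp (colourings (bern p) (size l))
    (fun b => ((csum l b)%:R <= t * (sumn l)%:R :> R)%:R).

Definition conc (l : seq nat) (L : R) : R :=
  fexp (colourings (bern2 p) (size l)) (urn (fun a b _ => (`|a%:R - b%:R| <= L :> R)%:R) l).

Lemma fexp_colouring_variance N (c : nat -> R) :
  fexp (colourings (bern p) N)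
    (fun b => (\sum_(j < N) c j * ((nth false b j)%:R - p)) ^+ 2) =
  p * (1 - p) * \sum_(j < N) c j ^+ 2.
Proof.
elim: N => [|N IH]; first by rewrite fexp_colouring0 !big_ord0 expr0n mulr0.
rewrite fexp_colouringS big_ord_recr /= mulrDr -IH.
rewrite -[X in _ + X](fexp_cst _ (fdist_colourings N (fdist_bern p01))) -fexpD.
apply: eq_fexp_in => x /colouring_size xN.
rewrite /fexp !big_cons big_nil /= !big_ord_recr /= !nth_rcons xN ltnn eqxx /=.
have E k : \sum_(j < N) c j * ((nth false (rcons x.2 k) j)%:R - p) =
    \sum_(j < N) c j * ((nth false x.2 j)%:R - p).
  by apply: eq_bigr => j _; rewrite nth_rcons xN ltn_ord.
by rewrite !E; ring.
Qed.

Lemma conc_ge0 l L : 0 <= conc l L.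
Proof. by apply: fexp_ge0 => [|s]; [exact/fdist_colourings/fdist_bern2|exact: ler0n]. Qed.

Lemma csum_unzip l (s : seq (bool * bool)) : size s = size l ->
  (csum l (unzip1 s))%:R - (csum l (unzip2 s))%:R =
  (cnt (false, false) only1 l s)%:R - (cnt (false, false) only2 l s)%:R :> R.
Proof.
move=> sl; rewrite !natr_sum -!sumrB; apply: eq_bigr => j _; rewrite !natrM.
rewrite (nth_map (false, false)) ?sl// (nth_map (false, false)) ?sl//.
by case: (nth (false, false) s j) => [[] []] /=; lra.
Qed.

(* The square of the mass of a window is the probability that two independent
   copies fall in it, hence at most that their difference is small. *)
Lemma window_mass l (U : pred (seq bool)) L :
  (forall b b', U b -> U b' -> `|(csum l b)%:R - (csum l b')%:R| <= L) ->
  fexp (colourings (bern p) (size l)) (fun b => (U b)%:R) ^+ 2 <= conc l L.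
Proof.
move=> UL; rewrite expr2 -fexp_colouring_pair; apply: fexp_le_in.
  exact/fdist_colourings/fdist_bern2.
move=> [w s] /colouring_size /= sl; rewrite /urn -csum_unzip//.
have := UL (unzip1 s) (unzip2 s).
case: (U _) => /=; case: (U _) => /=; rewrite ?mul0r ?mulr0 ?ler0n// mulr1.
by move=> /(_ isT isT) ->.
Qed.

(** Either the mass is at most [e], or it is at most its square over [e]. This linear form of the
    square root lets the mean of [conc] be taken directly. *)
Lemma window_mass_le l (U : pred (seq bool)) L e : 0 < e ->
  (forall b b', U b -> U b' -> `|(csum l b)%:R - (csum l b')%:R| <= L) ->
  fexp (colourings (bern p) (size l)) (fun b => (U b)%:R) <= e + conc l L / e.
Proof.
move=> e0 /window_mass; set k := fexp _ _ => kL; have c0 := conc_ge0 l L.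
have [ke|ek] := leP k e; first by rewrite (le_trans ke)// lerDl divr_ge0// ltW.
apply: (@le_trans _ _ (conc l L / e)); last by rewrite lerDr ltW.
rewrite ler_pdivlMr//; apply: le_trans kL; rewrite expr2 ler_wpM2l//.
  by rewrite ltW// (lt_trans e0).
exact: ltW.
Qed.

Lemma cdf_oscillation l (s t h e : R) : 0 < e -> `|s - t| <= h ->
  `|cdf l s - cdf l t| <= e + conc l (h * (sumn l)%:R) / e.
Proof.
wlog st : s t / s <= t.
  move=> W e0 sth; have [|/ltW] := leP s t; first by move=> st; exact: W.
  by move=> ts; rewrite distrC; apply: W => //; rewrite distrC.
move=> e0 sth; have n0 : 0 <= (sumn l)%:R :> R by [].
pose U b := (s * (sumn l)%:R < (csum l b)%:R) && ((csum l b)%:R <= t * (sumn l)%:R).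
have -> : `|cdf l s - cdf l t| =
    fexp (colourings (bern p) (size l)) (fun b => (U b)%:R).
  rewrite distrC ger0_norm; last first.
    rewrite subr_ge0; apply: fexp_le; first exact/fdist_colourings/fdist_bern.
    move=> b; rewrite ler_nat; case: (boolP (_ <= s * _)) => // h1.
    by rewrite (le_trans h1)// ler_wpM2r.
  rewrite -fexpB; apply: eq_fexp => b; rewrite /U ltNge.
  case: (boolP (_ <= s * _)) => //= h1; last by rewrite subr0.
  by rewrite (le_trans h1) ?ler_wpM2r// subrr.
apply: window_mass_le => // b b' /andP[h1 h2] /andP[h3 h4].
have := ler_wpM2r n0 sth; apply: le_trans.
have -> : `|s - t| = t - s by rewrite distrC ger0_norm// subr_ge0.
by rewrite mulrBl ler_norml; lra.
Qed.

(** With the same colours at both times, the two indicators differ only if [S_n/n] lies within [h]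
    of [t] or if [|S_m/m - S_n/n| > h]. The former is a window of length [2 h n]; the latter is
    bounded by Chebyshev's inequality. *)
Lemma cdf_comparison k ds (h e : R) : (k < size ds)%N -> 0 < e -> 0 < h ->
  let l' := tables ds in let l := tables (drop k ds) in
  let m := (size ds)%:R : R in let n := (size (drop k ds))%:R : R in
  forall t, `|cdf l' t - cdf l t| <= e + conc l (2 * h * n) / e +
    h ^- 2 * \sum_(j < size l') ((nth 0%N l' j)%:R / m - (nth 0%N l j)%:R / n) ^+ 2.
Proof.
move=> kds e0 h0 l' l m n t.
have n0 : 0 < n by rewrite ltr0n size_drop subn_gt0.
have m0 : 0 < m by rewrite ltr0n (leq_ltn_trans _ kds).
have ll' : (size l <= size l')%N := tables_drop_size k ds.
have sl : (sumn l)%:R = n by rewrite tables_size_sumn.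
have sl' : (sumn l')%:R = m by rewrite tables_size_sumn.
have bd := fdist_colourings (size l') (fdist_bern p01).
pose c j : R := (nth 0%N l' j)%:R / m - (nth 0%N l j)%:R / n.
have lE (f : nat -> R) : \sum_(j < size l') (nth 0%N l j)%:R * f j =
    \sum_(j < size l) (nth 0%N l j)%:R * f j.
  rewrite -(big_mkord xpredT (fun j => (nth 0%N l j)%:R * f j)).
  rewrite -[RHS](big_mkord xpredT (fun j => (nth 0%N l j)%:R * f j)).
  rewrite (big_cat_nat (n := size l))//= [X in _ + X]big_nat [X in _ + X]big1 ?addr0//.
  by move=> j /andP[lj _]; rewrite nth_default ?mul0r.
(* Both normalised size vectors have total 1, so the difference of the two sums is centred and only
   its variance remains. *)
have c_sum : \sum_(j < size l') c j = 0.
  rewrite sumrB -!mulr_suml cross_sumn sl' divff ?gt_eqF//.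
  have := lE (fun=> 1); under eq_bigr do rewrite mulr1; move=> ->.
  by under eq_bigr do rewrite mulr1; rewrite cross_sumn sl divff ?gt_eqF// subrr.
have cS b : (csum l' b)%:R / m - (csum l b)%:R / n =
    \sum_(j < size l') c j * ((nth false b j)%:R - p).
  under eq_bigr do rewrite mulrBr.
  rewrite [RHS]sumrB -mulr_suml c_sum mul0r subr0 /csum /cnt !natr_sum.
  under [\sum_(j < size l) _]eq_bigr do rewrite natrM.
  rewrite -(lE (fun j => (nth false b j)%:R)) !mulr_suml -sumrB; apply: eq_bigr => j _.
  by rewrite natrM mulrBl; congr (_ - _); rewrite mulrAC.
have widen (f : nat -> R) : fexp (colourings (bern p) (size l)) (fun b => f (csum l b))
    = fexp (colourings (bern p) (size l')) (fun b => f (csum l b)).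
  rewrite [RHS](@fexp_colouring_widen R _ _ (size l))//; first exact: fdist_bern.
  by move=> b k0 lb; rewrite /csum cnt_rcons.
pose U b := `|(csum l b)%:R / n - t| <= h.
have key b : `| ((csum l' b)%:R <= t * m :> R)%:R - ((csum l b)%:R <= t * n :> R)%:R | <=
    (U b)%:R + h ^- 2 * (\sum_(j < size l') c j * ((nth false b j)%:R - p)) ^+ 2 :> R.
  rewrite -cS -!ler_pdivrMr//.
  set x := _ / m; set z := _ / n.
  have q0 : 0 <= h ^- 2 * (x - z) ^+ 2.
    by apply: mulr_ge0; [rewrite invr_ge0 exprn_ge0// ltW|exact: sqr_ge0].
  have [ub|nub] := boolP (U b).
    apply: (@le_trans _ _ 1); last by rewrite lerDl.
    by case: (x <= t); case: (z <= t); rewrite /= ?subrr ?subr0 ?sub0r ?normrN ?normr0 ?normr1.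
  rewrite add0r; have [xh|hx] := leP `|x - z| h; last first.
    apply: (@le_trans _ _ 1).
      by case: (x <= t); case: (z <= t); rewrite /= ?subrr ?subr0 ?sub0r ?normrN ?normr0 ?normr1.
    rewrite mulrC ler_pdivlMr ?exprn_gt0// mul1r -[X in _ <= X]real_normK ?num_real//.
    by rewrite ler_pXn2r ?nnegrE ?(ltW h0)//; exact: ltW.
  suff -> : (x <= t) = (z <= t) by rewrite subrr normr0.
  move: nub xh; rewrite /U -/z -ltNge ler_norml ltr_normr => /orP nub /andP[xh1 xh2].
  by apply/idP/idP => ?; case: nub => ?; lra.
have F0 : `|cdf l' t - cdf l t| <= fexp (colourings (bern p) (size l')) (fun b =>
    (U b)%:R + h ^- 2 * (\sum_(j < size l') c j * ((nth false b j)%:R - p)) ^+ 2).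
  rewrite /cdf (widen (fun z => (z%:R <= t * (sumn l)%:R :> R)%:R)) sl sl' -fexpB.
  rewrite ler_norml lerNl -[X in X <= _]mulN1r -fexpZ !fexp_le// => b.
    by rewrite (le_trans (ler_norm _)).
  by rewrite mulN1r (le_trans _ (key b))// -normrN ler_norm.
apply: le_trans F0 _; rewrite fexpD fexpZ fexp_colouring_variance.
apply: lerD.
  rewrite -(widen (fun z => (`|z%:R / n - t| <= h :> R)%:R)).
  apply: window_mass_le => // b b'.
  rewrite !ler_distl => /andP[h1 h2] /andP[h3 h4].
  rewrite ler_pdivlMr// in h1; rewrite ler_pdivlMr// in h3.
  rewrite ler_pdivrMr// in h2; rewrite ler_pdivrMr// in h4.
  by apply/andP; split; lra.
apply: ler_wpM2l; first by rewrite invr_ge0 exprn_ge0// ltW.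
rewrite -[leRHS]mul1r ler_wpM2r//; last by move: p01 => /andP[? ?]; nra.
by apply: sumr_ge0 => j _; exact: sqr_ge0.
Qed.

(** [n] and [h] are chosen before [m], and one error [Phi] controls both the distance to the later
    state and the oscillation at time [n]. *)
Lemma main_estimate (e : R) : 0 < e -> exists n (h : R), [/\ (0 < n)%N, 0 < h &
  forall m, (n <= m)%N -> exists Phi : seq nat -> R,
    [/\ forall ds, 0 <= Phi ds, fexp (digits m) Phi <= e &
     forall ds, size ds = m ->
      (forall t, `|cdf (tables ds) t - cdf (tables (drop (m - n) ds)) t| <= Phi ds) /\
      (forall s t, `|s - t| <= h -> `|cdf (tables (drop (m - n) ds)) s -
                                     cdf (tables (drop (m - n) ds)) t| <= Phi ds)]].
Proof.
move=> e0; pose d := e / 3; have d0 : 0 < d by rewrite divr_gt0.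
(* The square is needed because [conc] gets divided by [d]. Below, [h2] is half of [h] since a
   window of radius [h2] has length [2 h2]. *)
have [h h0 [n0 conc0]] := annealed_concentration p01 (exprn_gt0 2 d0).
pose h2 := h / 2; have h20 : 0 < h2 by rewrite divr_gt0.
pose n := (n0 + Num.truncn (h2 ^- 2 / d)).+1.
have nh : h2 ^- 2 / n%:R <= d.
  rewrite ler_pdivrMr// mulrC -ler_pdivrMr//; apply: ltW.
  apply: lt_le_trans (truncnS_gt _) _; rewrite ler_nat /n.
  by move: (Num.truncn _) => T; clear; lia.
exists n, h; split => // m nm.
pose D ds : R := let l' := tables ds in let l := tables (drop (m - n) ds) in
  \sum_(j < size l') ((nth 0%N l' j)%:R / m%:R - (nth 0%N l j)%:R / n%:R) ^+ 2.
pose Phi ds := d + conc (tables (drop (m - n) ds)) (h * n%:R) / d + h2 ^- 2 * D ds.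
have D0 ds : 0 <= h2 ^- 2 * D ds.
  rewrite mulr_ge0 ?invr_ge0 ?exprn_ge0 ?(ltW h20)//.
  by apply: sumr_ge0 => j _; exact: sqr_ge0.
have C0 ds : 0 <= conc (tables (drop (m - n) ds)) (h * n%:R) / d.
  by rewrite divr_ge0 ?conc_ge0// ltW.
exists Phi; split.
- by move=> ds; rewrite !addr_ge0// ltW.
- rewrite /Phi !fexpD (fexpZ _ (h2 ^- 2) D) fexpZr fexp_cst; last exact: fdist_digits.
  have -> : fexp (digits m) (fun ds => conc (tables (drop (m - n) ds)) (h * n%:R)) =
      annealed p n (fun a b _ => (`|a%:R - b%:R| <= h * n%:R :> R)%:R).
    rewrite -{1}(subnK nm).
    exact: (@fexp_digits_drop R (m - n) n (fun ds => conc (tables ds) (h * n%:R))).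
  have cd : annealed p n (fun a b _ => (`|a%:R - b%:R| <= h * n%:R :> R)%:R) / d <= d.
    rewrite ler_pdivrMr// -expr2; apply: conc0; rewrite /n.
    by move: (Num.truncn _) => T; clear; lia.
  have -> : fexp (digits m) D = (n%:R^-1 - m%:R^-1) / 2.
    by have := @fexp_sqdist R (m - n) n isT; rewrite subnK.
  have : h2 ^- 2 * ((n%:R^-1 - m%:R^-1) / 2) <= d.
    apply: le_trans nh; rewrite ler_wpM2l ?invr_ge0 ?exprn_ge0 ?(ltW h20)//.
    have : 0 <= m%:R^-1 :> R by rewrite invr_ge0.
    have : 0 <= n%:R^-1 :> R by rewrite invr_ge0.
    lra.
  by rewrite (_ : e = d + d + d); [lra|rewrite /d; lra].
- move=> ds dsm; have dn : size (drop (m - n) ds) = n by rewrite size_drop dsm subKn.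
  split=> [t|s t st].
    have kds : (m - n < size ds)%N by rewrite dsm; move: nm; rewrite /n; clear; lia.
    have := @cdf_comparison _ _ _ _ kds d0 h20 t; rewrite /= dsm dn.
    by rewrite (_ : 2 * h2 = h)//; rewrite /h2; lra.
  have := @cdf_oscillation (tables (drop (m - n) ds)) _ _ _ _ d0 st.
  rewrite tables_size_sumn dn => /le_trans; apply.
  by rewrite /Phi lerDl.
Qed.

End quenched.

(** * Cycle types of uniform permutations *)

Section cycle_insertion.
Variable n : nat.
Implicit Types (s : {perm 'I_n}) (i : 'I_n.+1) (x y : 'I_n).

(** The order of the lengths is that of [enum] and carries no meaning; it is only used up to
    [perm_eq]. *)
Definition cycle_type m (s : {perm 'I_m}) : seq nat :=
  [seq #|c| | c : {set 'I_m} <- enum (porbits s)].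

Let inj : 'I_n -> 'I_n.+1 := lift ord_max.

Let inj_inj : injective inj. Proof. exact: lift_inj. Qed.

Let inj_max x : (inj x == ord_max) = false.
Proof. by rewrite eq_sym; apply/negbTE/neq_lift. Qed.

(* The point [ord_max] becomes a fixed point, or is inserted just before [i]. *)
Definition insert_cycle s i : {perm 'I_n.+1} :=
  (lift_perm ord_max ord_max s * tperm ord_max i)%g.

Lemma insert_cycle_max s i : insert_cycle s i ord_max = i.
Proof. by rewrite permM lift_perm_id tpermL. Qed.

Lemma insert_cycle_lift s i x :
  insert_cycle s i (inj x) = if inj (s x) == i then ord_max else inj (s x).
Proof.
rewrite permM lift_perm_lift -/(inj _) permE /=.
by rewrite inj_max; case: eqP => // ->.
Qed.

(** [i] is recovered as the image of [ord_max], and the cardinalities agree. A uniform permutation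
    of [n + 1] points is thus a uniform one of [n] points with a uniform, independent place of
    insertion. *)
Lemma insert_cycle_bij :
  bijective (fun si : {perm 'I_n} * 'I_n.+1 => insert_cycle si.1 si.2).
Proof.
apply: inj_card_bij; last by rewrite card_prod !card_Sn card_ord factS mulnC.
move=> [s i] [t j] /= st.
have ij : i = j by rewrite -(insert_cycle_max s i) st insert_cycle_max.
subst j; congr (_, _); have {}st := mulIg _ _ _ st.
apply/permP => x; apply: inj_inj.
by rewrite /inj -(lift_perm_lift ord_max ord_max) st lift_perm_lift.
Qed.

Lemma porbit_sub_stable (T : finType) (t : {perm T}) z (B : {set T}) :
  z \in B -> (forall u, u \in B -> t u \in B) -> porbit t z \subset B.
Proof.
move=> zB tB; apply/fintype.subsetP => u /porbitP[k ->].
by elim: k => [|k IH]; rewrite ?expg0 ?perm1// expgSr permM tB.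
Qed.

Lemma porbit_step (T : finType) (t : {perm T}) z : porbit t (t z) = porbit t z.
Proof. by have := porbit_perm t 1 z; rewrite expg1. Qed.

(** A step of [s] is one step of the new permutation, or two when it passes through [ord_max]. *)
Lemma lift_porbit_sub s i x :
  (inj @: porbit s x)%SET \subset porbit (insert_cycle s i) (inj x).
Proof.
apply/fintype.subsetP => _ /imsetP[y /porbitP[k ->] ->]; set t := insert_cycle s i.
elim: k => [|k IH]; first by rewrite expg0 perm1 porbit_id.
rewrite expgSr permM; move: ((s ^+ k)%g x) IH => y' IH.
have := IH; rewrite -eq_porbit_mem => /eqP <-.
have e := insert_cycle_lift s i y'; case: ifP e => [/eqP ei e|_ <-]; last first.
  by have := mem_porbit t 1 (inj y'); rewrite expg1.
have := mem_porbit t 2 (inj y').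
by rewrite expgSr expg1 permM [t (inj y')]e insert_cycle_max -ei.
Qed.

Lemma card_inj (c : {set 'I_n}) : #|(inj @: c)%SET| = #|c|.
Proof. exact: card_imset. Qed.

Lemma max_notin_inj (c : {set 'I_n}) : (ord_max \in inj @: c)%SET = false.
Proof. by apply/negbTE/imsetP => -[x _ /esym/eqP]; rewrite inj_max. Qed.

Lemma cycle_type_insert s (t : {perm 'I_n.+1}) (c : {set 'I_n.+1}) (D : {set {set 'I_n}}) :
  porbits t = (c |: [set inj @: d | d : {set 'I_n} in D])%SET -> ord_max \in c ->
  perm_eq (cycle_type t) (#|c| :: [seq #|d| | d : {set 'I_n} <- enum D]).
Proof.
move=> tE mc; rewrite /cycle_type tE.
have cD : c \notin [set inj @: d | d : {set 'I_n} in D]%SET.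
  by apply/imsetP => -[d _ cd]; move: mc; rewrite cd max_notin_inj.
have e1 : perm_eq (enum (c |: [set inj @: d | d : {set 'I_n} in D])%SET)
    (c :: enum [set inj @: d | d : {set 'I_n} in D]%SET).
  apply: uniq_perm; rewrite /= ?mem_enum ?cD ?enum_uniq// => z.
  by rewrite mem_enum !inE mem_enum.
have e2 : perm_eq (enum [set inj @: d | d : {set 'I_n} in D]%SET)
    [seq (inj @: d)%SET | d : {set 'I_n} <- enum D].
  apply: uniq_perm; rewrite ?enum_uniq ?map_inj_uniq ?enum_uniq//.
    exact: imset_inj inj_inj.
  move=> z; rewrite mem_enum; apply/imsetP/mapP => -[d dD ->]; exists d => //.
    by rewrite mem_enum.
  by rewrite mem_enum in dD.
apply: (perm_trans (perm_map _ e1)) => /=; rewrite perm_cons.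
apply: (perm_trans (perm_map _ e2)); rewrite -map_comp.
suff -> : forall r, map ((fun c0 : {set 'I_n.+1} => #|c0|) \o
    (fun d : {set 'I_n} => [set inj x | x in d]%SET)) r = [seq #|d| | d : {set 'I_n} <- r] by [].
by move=> r; apply: eq_map => d; exact: card_inj.
Qed.

Lemma porbits_image m (t : {perm 'I_m}) z : porbit t z \in porbits t.
Proof. by apply/imsetP; exists z. Qed.

Lemma cycle_type_new s :
  perm_eq (cycle_type (insert_cycle s ord_max)) (1%N :: cycle_type s).
Proof.
set t := insert_cycle s ord_max.
have tl x : t (inj x) = inj (s x) by rewrite insert_cycle_lift inj_max.
have bm : porbit t ord_max = [set ord_max]%SET.
  apply/eqP; rewrite finset.eqEsubset finset.sub1set porbit_id andbT porbit_sub_stable ?finset.set11//.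
  by move=> u; rewrite !inE => /eqP ->; rewrite insert_cycle_max.
have bl x : porbit t (inj x) = (inj @: porbit s x)%SET.
  apply/eqP; rewrite finset.eqEsubset lift_porbit_sub andbT porbit_sub_stable//.
    by rewrite imset_f ?porbit_id.
  move=> _ /imsetP[y yx ->]; rewrite tl imset_f//.
  by move: yx; rewrite -!eq_porbit_mem porbit_step.
have := @cycle_type_insert s t [set ord_max]%SET (porbits s).
rewrite cards1; apply; last exact: finset.set11.
apply/setP => c; rewrite !inE; apply/imsetP/orP.
  move=> [z _ ->]; case: (unliftP ord_max z) => [x|] ->.
    by right; rewrite -/(inj x) bl; apply/imset_f/porbits_image.
  by left; rewrite bm.
move=> [/eqP ->|/imsetP[_ /imsetP[x _ ->] ->]]; first by exists ord_max.
by exists (inj x); rewrite ?bl.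
Qed.

Lemma cycle_type_join s x :
  perm_eq (cycle_type (insert_cycle s (inj x)))
          (#|porbit s x|.+1 :: rem #|porbit s x| (cycle_type s)).
Proof.
set t := insert_cycle s (inj x); set c0 := porbit s x.
pose c := (ord_max |: inj @: c0)%SET.
have xc0 : x \in c0 by exact: porbit_id.
have tl y : t (inj y) = if s y == x then ord_max else inj (s y).
  by rewrite insert_cycle_lift (inj_eq inj_inj).
have sc0 y : (s y \in c0) = (y \in c0).
  by rewrite -!eq_porbit_mem porbit_step.
have c_stable u : u \in c -> t u \in c.
  rewrite !inE => /orP[/eqP ->|/imsetP[y yc0 ->]].
    by rewrite insert_cycle_max imset_f ?orbT.
  by rewrite tl; case: ifP => _; rewrite ?eqxx// imset_f ?sc0 ?orbT.
have mx : ord_max \in porbit t (inj x).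
  rewrite porbit_sym; have := mem_porbit t 1 ord_max.
  by rewrite expg1 insert_cycle_max.
have bx : porbit t (inj x) = c.
  apply/eqP; rewrite finset.eqEsubset porbit_sub_stable//=; last by rewrite !inE imset_f ?orbT.
  by rewrite finset.subUset finset.sub1set mx lift_porbit_sub.
have bc0 y : y \in c0 -> porbit t (inj y) = c.
  move=> yc0; rewrite -bx; apply/eqP; rewrite eq_porbit_mem bx.
  by rewrite !inE imset_f ?orbT.
have bm : porbit t ord_max = c.
  by rewrite -bx; apply/eqP; rewrite eq_porbit_mem.
have bl y : y \notin c0 -> porbit t (inj y) = (inj @: porbit s y)%SET.
  move=> yc0; apply/eqP; rewrite finset.eqEsubset lift_porbit_sub andbT porbit_sub_stable//.
    by rewrite imset_f ?porbit_id.
  move=> _ /imsetP[z zy ->]; rewrite tl; case: eqP => [zx|_].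
    move: yc0; rewrite /c0 -zx -eq_porbit_mem porbit_step.
    by move: zy; rewrite -eq_porbit_mem eq_sym => /eqP ->; rewrite eqxx.
  by rewrite imset_f//; move: zy; rewrite -!eq_porbit_mem porbit_step.
have tE : porbits t = (c |: [set inj @: d | d : {set 'I_n} in porbits s :\ c0])%SET.
  apply/setP => d; rewrite !inE; apply/imsetP/orP.
    move=> [z _ ->]; case: (unliftP ord_max z) => [y|] ->; last by left; rewrite bm.
    rewrite -/(inj y); have [yc0|yc0] := boolP (y \in c0); first by left; rewrite bc0.
    right; rewrite bl//; apply: imset_f; rewrite !inE porbits_image andbT.
    by rewrite eq_porbit_mem.
  move=> [/eqP ->|/imsetP[d' + ->]]; first by exists ord_max; rewrite ?bm.
  rewrite !inE => /andP[d'c0 /imsetP[y _ yd']].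
  by exists (inj y) => //; rewrite bl ?yd'//; move: d'c0; rewrite yd' eq_porbit_mem.
have mc : ord_max \in c by rewrite !inE eqxx.
have cc : #|c| = #|c0|.+1 by rewrite /c cardsU1 max_notin_inj card_inj.
rewrite -cc; apply: (perm_trans (@cycle_type_insert s t c _ tE mc)).
rewrite perm_cons perm_sym -(perm_cons #|c0|).
apply: (@perm_trans _ (cycle_type s)).
  rewrite perm_sym; apply: perm_to_rem.
  by apply/mapP; exists c0 => //; rewrite mem_enum porbits_image.
rewrite -[X in perm_eq _ X]/(map (fun d : {set 'I_n} => #|d|) (c0 :: _)).
apply: perm_map; apply: uniq_perm; rewrite /= ?enum_uniq//.
  by rewrite mem_enum !inE eqxx.
move=> d; rewrite inE !mem_enum !inE; case: eqP => [->|//].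
by rewrite porbits_image.
Qed.

End cycle_insertion.

Lemma cycle_type0 (s : {perm 'I_0}) : cycle_type s = [::].
Proof.
apply/size0nil; rewrite /cycle_type size_map -cardE; apply/eqP; rewrite cards_eq0.
by apply/eqP/setP => c; rewrite !inE; apply/imsetP => -[[]].
Qed.

Lemma perm_swap (T : eqType) (a b : T) (r : seq T) :
  perm_eq (a :: b :: r) (b :: a :: r).
Proof. exact/permPl/(perm_catCA [:: a] [:: b] r). Qed.

Lemma perm_incr_nth (l : seq nat) j : (j < size l)%N ->
  perm_eq (incr_nth l j) ((nth 0%N l j).+1 :: rem (nth 0%N l j) l).
Proof.
move=> jl; set a := nth 0%N l j; rewrite -(perm_cons a).
have al : a \in l by exact: mem_nth.
apply: (@perm_trans _ (a.+1 :: l)); last first.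
  rewrite perm_sym; apply: perm_trans (perm_swap _ _ _) _.
  by rewrite perm_cons perm_sym perm_to_rem.
rewrite /a {a al}; elim: l j jl => // b l IH [|j] jl /=; first exact: perm_swap.
apply: perm_trans (perm_swap _ _ _) _; apply: (perm_trans _ (perm_swap _ _ _)).
by rewrite perm_cons IH.
Qed.

Lemma perm_rem (T : eqType) (a : T) (r r' : seq T) :
  perm_eq r r' -> perm_eq (rem a r) (rem a r').
Proof.
move=> rr'; have [ar|ar] := boolP (a \in r); last first.
  by rewrite !rem_id// -(perm_mem rr').
rewrite -(perm_cons a) -(permPl (perm_to_rem ar)) (permPl rr').
by rewrite perm_to_rem// -(perm_mem rr').
Qed.

Lemma incr_nth_size (l : seq nat) : incr_nth l (size l) = rcons l 1%N.
Proof. by elim: l => //= a l ->. Qed.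

Lemma sum_porbits {V : nmodType} m (s : {perm 'I_m}) (G : {set 'I_m} -> V) :
  \sum_(x < m) G (porbit s x) = \sum_(c in porbits s) G c *+ #|c|.
Proof.
rewrite (partition_big (porbit s) (mem (porbits s))) /=; last first.
  by move=> x _; exact: porbits_image.
apply: eq_bigr => c /imsetP[y _ ->]; rewrite (eq_bigr (fun=> G (porbit s y))).
  by rewrite sumr_const; congr (_ *+ _); apply: eq_card => x; rewrite -eq_porbit_mem.
by move=> x /eqP ->.
Qed.

Section cycle_type_law.
Context {R : realType}.

(** One restaurant step written for unordered sizes, in a form that fits both tables and cycles. *)
Definition table_average (F : seq nat -> R) (l : seq nat) : R :=
  (sumn l).+1%:R^-1 * (\sum_(a <- l) a%:R * F (a.+1 :: rem a l) + F (1%N :: l)).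

Lemma table_average_perm F :
  (forall l l', perm_eq l l' -> F l = F l') ->
  forall l l', perm_eq l l' -> table_average F l = table_average F l'.
Proof.
move=> HF l l' ll'; rewrite /table_average (perm_sumn ll') (perm_big _ ll') /=.
congr (_ * (_ + _)); last by apply: HF; rewrite perm_cons.
apply: eq_bigr => a _; congr (_ * _); apply: HF.
by rewrite perm_cons; exact: perm_rem.
Qed.

Lemma cycle_type_sumn n (s : {perm 'I_n}) : sumn (cycle_type s) = n.
Proof.
rewrite sumnE big_map big_enum /=.
have := sum_porbits s (fun=> 1%N); rewrite sumr_const card_ord natn => nE.
apply: etrans (esym nE); by apply: eq_bigr => c _; rewrite natn.
Qed.

Lemma sum_cycle_type_insert n (s : {perm 'I_n}) (F : seq nat -> R) :
  (forall l l', perm_eq l l' -> F l = F l') ->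
  \sum_i F (cycle_type (insert_cycle s i)) =
  n.+1%:R * table_average F (cycle_type s).
Proof.
move=> HF; rewrite /table_average cycle_type_sumn mulrA divff ?pnatr_eq0// mul1r.
rewrite big_ord_recr /= (HF _ _ (cycle_type_new s)); congr (_ + _).
rewrite big_map big_enum /=.
transitivity (\sum_(x < n) F (#|porbit s x|.+1 :: rem #|porbit s x| (cycle_type s))).
  apply: eq_bigr => x _; rewrite -(HF _ _ (cycle_type_join s x)).
  congr (F (cycle_type (insert_cycle s _))); apply: val_inj => /=.
  by rewrite /bump leqNgt ltn_ord.
rewrite (sum_porbits s (fun c => F (#|c|.+1 :: rem #|c| (cycle_type s)))).
by apply: eq_bigr => c _; rewrite mulr_natl.
Qed.

(** Both sides satisfy the recursion given by [table_average]. Symmetry of [F] is required: tables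
    are listed by time of opening, cycles by [enum]. *)
Lemma fexp_tables_cycle_type n (F : seq nat -> R) :
  (forall l l', perm_eq l l' -> F l = F l') ->
  fexp (digits n) (fun ds => F (tables ds)) =
  (n`!)%:R^-1 * \sum_(s : {perm 'I_n}) F (cycle_type s).
Proof.
elim: n F => [|n IH] F HF.
  rewrite fexp_digits0 fact0 invr1 mul1r (bigD1 1%g) //= big1 ?addr0; last first.
    by move=> s /eqP []; apply/permP => -[].
  by rewrite cycle_type0.
rewrite (fexp_digits_tables n (fun _ => F)) /=.
transitivity (fexp (digits n) (fun ds => table_average F (tables ds))).
  apply: eq_fexp_in => x /digits_size xn; rewrite /table_average tables_size_sumn xn.
  congr (_ * (_ + _)); last by apply: HF; rewrite incr_nth_size perm_rcons.
  rewrite [RHS](big_nth 0%N) big_mkord; apply: eq_bigr => j _; congr (_ * _).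
  exact/HF/perm_incr_nth.
rewrite IH; last exact: table_average_perm.
rewrite [in RHS](reindex _ (onW_bij _ (@insert_cycle_bij n))) /=.
rewrite -(pair_bigA _ (fun s i => F (cycle_type (insert_cycle s i)))) /=.
under [in RHS]eq_bigr => s _ do rewrite (sum_cycle_type_insert _ HF).
rewrite -mulr_sumr mulrA; congr (_ * _).
by rewrite factS natrM invfM mulrAC mulVf ?mul1r// pnatr_eq0.
Qed.

End cycle_type_law.

(** * Divisor sums as distribution functions *)

Lemma sum_powerset_prod {A : comNzRingType} {I : finType} (P : {set I}) (F : I -> A) :
  \sum_(J in powerset P) \prod_(c in J) F c = \prod_(c in P) (1 + F c).
Proof.
rewrite [RHS]big_mkcond /=.
transitivity (\prod_c ((if c \in P then F c else 0) + 1)); last first.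
  by apply: eq_bigr => c _; case: ifP => _; rewrite ?add0r// addrC.
rewrite (bigA_distr _ _ (fun c => if c \in P then F c else 0) (fun=> 1)).
rewrite [LHS]big_mkcond [RHS]big_mkcond; apply: eq_bigr => J _ /=.
rewrite powersetE; case: (boolP (J \subset P)) => [JP|/subsetPn[c cJ cP]].
  rewrite big_mkcond; apply: eq_bigr => c _; case: ifP => // cJ.
  by rewrite (fintype.subsetP JP).
by rewrite (bigD1 c)//= cJ (negbTE cP) mul0r.
Qed.

Lemma sum_nat_select (G : nat -> nat) n a : (0 < a <= n)%N ->
  (\sum_(1 <= j < n.+1) G j * (a == j) = G a)%N.
Proof.
move=> an; rewrite (bigD1_seq a) ?mem_index_iota ?iota_uniq//= eqxx muln1.
by rewrite big1 ?addn0// => j /negbTE; rewrite eq_sym => ->; rewrite muln0.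
Qed.

Section process_distribution.
Context {R : realType}.

Lemma divisor_stat n (s : {perm 'I_n}) (d : {set {set 'I_n}}) (G : nat -> nat) :
  d \subset porbits s ->
  (\sum_(1 <= j < n.+1) G j * ncycles j d = \sum_(c in d) G #|c|)%N.
Proof.
move=> ds; under eq_bigr => j _.
  rewrite /ncycles -sum1_card (eq_bigl (fun c : {set 'I_n} => (c \in d) && (#|c| == j))).
    rewrite big_mkcondr big_distrr /=.
    over.
  by move=> c; rewrite inE.
rewrite exchange_big /=; apply: eq_bigr => c cd.
rewrite -(@sum_nat_select G n #|c|).
  by apply: eq_bigr => j _; case: ifP.
have /imsetP[x _ ->] := fintype.subsetP ds _ cd.
apply/andP; split; first by rewrite (cardD1 x) porbit_id.
by apply: leq_trans (max_card _) _; rewrite card_ord.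
Qed.

(** The linear functional sending [X^k] to [f k] for [k < N]; with [f] an indicator it reads a
    distribution function off a generating polynomial. *)
Definition poly_sum (N : nat) (f : nat -> R) (P : {poly R}) : R :=
  \sum_(k < N) P`_k * f k.

Lemma poly_sum_sum N f I (r : seq I) (Q : pred I) (P : I -> {poly R}) :
  poly_sum N f (\sum_(i <- r | Q i) P i) = \sum_(i <- r | Q i) poly_sum N f (P i).
Proof.
rewrite exchange_big; apply: eq_bigr => k _ /=.
by rewrite coef_sum mulr_suml.
Qed.

Lemma poly_sumZ N f a P : poly_sum N f (a *: P) = a * poly_sum N f P.
Proof. by rewrite mulr_sumr; apply: eq_bigr => k _; rewrite coefZ mulrA. Qed.

Lemma poly_sumXn N f m : (m < N)%N -> poly_sum N f 'X^m = f m.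
Proof.
move=> mN; rewrite /poly_sum (bigD1 (Ordinal mN)) //= coefXn eqxx mul1r.
rewrite big1 ?addr0// => k; rewrite -val_eqE /= => /negbTE km.
by rewrite coefXn km mul0r.
Qed.

(** The generating polynomial of [csum] factors over the cycles by independence. In this form the
    order of [l] is visibly irrelevant. *)
Lemma colourings_poly (p : R) (l : seq nat) :
  \sum_(x <- colourings (bern p) (size l)) x.1 *: 'X^(csum l x.2) =
  \prod_(a <- l) ((1 - p)%:P + p *: 'X^a).
Proof.
elim/last_ind: l => [|l a IH].
  by rewrite big_nil big_cons big_nil /= /csum cnt_nil expr0 scale1r addr0.
rewrite size_rcons /= big_allpairs_dep /= big_rcons /= -IH mulr_suml.
apply: eq_big_seq => x /colouring_size xl; rewrite !big_cons big_nil /= addr0.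
have E k : csum (rcons l a) (rcons x.2 k) = (csum l x.2 + a * k)%N.
  rewrite /csum /cnt size_rcons big_ord_recr /= !nth_rcons xl ltnn eqxx; congr addn.
  by apply: eq_bigr => j _; rewrite !nth_rcons xl ltn_ord.
rewrite !E muln1 muln0 addn0 exprD [RHS]mulrDr [LHS]addrC; congr (_ + _).
  by rewrite [RHS]mulrC mul_polyC scalerA mulrC.
by rewrite -scalerAl -scalerAr scalerA.
Qed.

Lemma cdf_poly (p : R) (l : seq nat) t : cdf p l t =
  poly_sum (sumn l).+1 (fun k => (k%:R <= t * (sumn l)%:R :> R)%:R)
    (\prod_(a <- l) ((1 - p)%:P + p *: 'X^a)).
Proof.
rewrite -colourings_poly poly_sum_sum; apply: eq_bigr => x _.
by rewrite poly_sumZ poly_sumXn// ltnS; exact: cnt_le.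
Qed.

Lemma cdf_perm (p : R) (l l' : seq nat) t : perm_eq l l' -> cdf p l t = cdf p l' t.
Proof. by move=> ll'; rewrite !cdf_poly (perm_sumn ll') (perm_big _ ll'). Qed.

(** Each factor is [(1 + theta)^-1 (1 + theta X^a)]. Expanding the product over sets of cycles gives
    one term [theta^w X^size] for each divisor, and the scalars multiply to [1 / f(sigma)]. *)
Lemma process_fun_cdf (theta : R) n (s : {perm 'I_n}) t : 0 < theta ->
  process_fun (fun=> theta) s t = cdf (theta / (1 + theta)) (cycle_type s) t.
Proof.
move=> th0; set p := theta / (1 + theta).
have th1 : 1 + theta != 0 by rewrite gt_eqF// addr_gt0.
have dcE (d : {set {set 'I_n}}) : d \subset porbits s -> dcycles d = #|d|.
  move=> ds; rewrite -sum1_card -(divisor_stat (fun=> 1%N) ds).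
  by apply: eq_bigr => j _; rewrite mul1n.
have dsE (d : {set {set 'I_n}}) : d \subset porbits s -> dsize d = (\sum_(c in d) #|c|)%N.
  by move=> ds; rewrite -(divisor_stat id ds).
have tot : divisor_total (fun=> theta) s = (1 + theta) ^+ #|porbits s|.
  rewrite -prodr_const -(sum_powerset_prod _ (fun=> theta)); apply: eq_bigr => d.
  by rewrite powersetE => ds; rewrite cmult_cst dcE// prodr_const.
have sumC : (\sum_(c in porbits s) #|c|)%N = n.
  by rewrite -[RHS](cycle_type_sumn s) sumnE big_map big_enum.
pose f k : R := (k%:R <= t * n%:R :> R)%:R.
rewrite /process_fun tot cdf_poly cycle_type_sumn -/f.
apply/esym.
rewrite big_map big_enum /=.
rewrite (eq_bigr (fun c : {set 'I_n} => (1 + theta)^-1 *: (1 + theta *: 'X^#|c|))); last first.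
  move=> c _; rewrite scalerDr scalerA; congr (_ + _ *: _).
    by rewrite -alg_polyC; congr (_ *: _); rewrite /p; field.
  by rewrite /p mulrC.
rewrite scaler_prod prodr_const exprVn poly_sumZ; congr (_ * _).
rewrite -sum_powerset_prod poly_sum_sum big_mkcondr; apply: eq_bigr => d.
rewrite powersetE => ds.
rewrite scaler_prod prodr_const poly_sumZ -(big_morph _ (exprD 'X) (expr0 'X)) -dsE//.
rewrite poly_sumXn; last first.
  rewrite ltnS dsE// -[leqRHS]sumC [leqRHS](big_setID d) /=.
  by rewrite (finset.setIidPr ds) leq_addr.
by rewrite cmult_cst dcE// /f; case: ifP => _; rewrite ?mulr1 ?mulr0.
Qed.

End process_distribution.

(** * Skorokhod space *)

Section skorokhod_lemmas.
Context {R : realType}.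
Implicit Types x y : skorokhod R.

Lemma skorokhod_eq x y : x =1 y -> x = y.
Proof.
case: x y => [f fc fo] [g gc go] /= /funext fg; subst g.
by rewrite (Prop_irrelevance fc gc) (Prop_irrelevance fo go).
Qed.

Lemma skorokhod_outE x t : t \notin `[0, 1] -> x t = 0.
Proof. by move=> t01; rewrite -skorokhod_out patchE memNset//; exact/negP. Qed.

Lemma skorokhod_open_measurable (A : set (skorokhod R)) : open A -> measurable A.
Proof. by move=> oA; exact: sub_sigma_algebra. Qed.

Lemma uniform_skorokhod_ball x y (r e : R) : r < e ->
  (forall t, t \in `[0, 1] -> `|x t - y t| <= r) -> ball x e y.
Proof.
move=> re xy; exists idfun, r; split => //.
- split => //; last by rewrite image_id.
  by apply: continuous_subspaceT => ?; exact: cvg_id.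
- move=> t t01; split; last exact: xy.
  by rewrite /= subrr normr0 (le_trans _ (xy t t01)).
Qed.

Lemma skorokhod_continuous_measurable (f : skorokhod R -> R) :
  continuous f -> measurable_fun setT f.
Proof.
move=> /continuousP cf; apply: (measurability _ (RGenOpens.measurableE R)).
move=> _ [_ [a [b ->] <-]]; rewrite setTI; apply: skorokhod_open_measurable.
exact/cf/interval_open.
Qed.

Lemma within01P (f : R -> R) : {within `[0, 1]%classic, continuous f} <->
  forall t, t \in `[0, 1] -> forall e, 0 < e -> exists2 d, 0 < d &
    forall s, s \in `[0, 1] -> `|t - s| < d -> `|f t - f s| < e.
Proof.
split=> [/subspace_continuousP cf t t01 e e0|H].
  have /cvgrPdist_lt/(_ e e0) := cf _ t01.
  rewrite near_withinE => /nbhs_ballP[d d0 dP]; exists d => // s s01 ts.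
  exact: dP.
apply/subspace_continuousP => t t01; apply/cvgrPdist_lt => e e0.
have [d d0 dP] := H t t01 e e0.
rewrite near_withinE; apply/nbhs_ballP; exists d => // s ts s01.
exact: dP.
Qed.

Lemma within01_cadlag (f : R -> R) :
  {within `[0, 1]%classic, continuous f} -> cadlag f.
Proof.
move=> /within01P cf; split=> t /andP[t0 t1].
  apply/cvgrPdist_lt => e e0.
  have t01 : t \in `[0, 1] by rewrite in_itv/= t0 ltW.
  have [d d0 dP] := cf t t01 e e0.
  near=> s; apply: dP.
    rewrite in_itv/=; apply/andP; split; last by near: s; exact: nbhs_right_le.
    by rewrite (le_trans t0)// ltW//; near: s; exact: nbhs_right_gt.
  rewrite distrC ger0_norm; last by rewrite subr_ge0; near: s; exact: nbhs_right_ge.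
  by rewrite ltrBlDl; near: s; apply: nbhs_right_lt; rewrite ltrDl.
apply/cvg_ex; exists (f t); apply/cvgrPdist_lt => e e0.
have t01 : t \in `[0, 1] by rewrite in_itv/= ltW.
have [d d0 dP] := cf t t01 e e0.
near=> s; apply: dP.
  rewrite in_itv/=; apply/andP; split; first by near: s; exact: nbhs_left_ge.
  by apply: le_trans t1; near: s; exact: nbhs_left_le.
rewrite ger0_norm; last by rewrite subr_ge0; near: s; exact: nbhs_left_le.
by rewrite ltrBlDl -ltrBlDr; near: s; apply: nbhs_left_gt; rewrite gtrDl oppr_lt0.
Unshelve. all: by end_near. Qed.

(** If [y] is continuous and near [x], then [x] is uniformly near [y \o l], which is continuous
    because the time change [l] is. *)
Lemma C01_closed : closed (@C01 R).
Proof.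
move=> x xC; apply/within01P => t t01 e e0.
have e30 : 0 < e / 3 by rewrite divr_gt0.
have [y [/within01P yc [l [r [tl re lr]]]]] := xC _ (nbhsx_ballx x _ e30).
have lt01 := time_change_in tl t01.
have [d d0 dP] := yc _ lt01 _ e30.
have [/within01P lc _ _] := tl.
have [d' d'0 d'P] := lc _ t01 _ d0.
exists d' => // s s01 ts; have := dP _ (time_change_in tl s01) (d'P _ s01 ts).
have [_] := lr t t01; have [_] := lr s s01.
rewrite !ler_norml !ltr_norml => /andP[? ?] /andP[? ?] /andP[? ?].
by apply/andP; split; lra.
Qed.

Lemma C01_measurable : measurable (@C01 R).
Proof.
rewrite -[X in measurable X]setCK; apply: measurableC; apply: skorokhod_open_measurable.
exact/closed_openC/C01_closed.
Qed.

(** [X w] lies in the open set [U] exactly when, for some [k], the [g j w] eventually lie in [V k],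
    the interior of the set of points whose ball of radius [1 / (k + 1)] is inside [U]. The interior
    makes [V k] open, hence measurable. *)
Lemma skorokhod_measurable_limit d (T : measurableType d)
    (g : nat -> T -> skorokhod R) (X : T -> skorokhod R) :
  (forall j, measurable_fun setT (g j)) ->
  (forall w (e : R), 0 < e -> exists N, forall j, (N <= j)%N -> ball (g j w) e (X w)) ->
  measurable_fun setT X.
Proof.
move=> mg gX; apply: (@measurability _ _ _ _ _ _ (@open (skorokhod R))) => //.
move=> _ [U oU <-]; rewrite setTI.
pose V k := [set x : skorokhod R | ball x (k.+1%:R^-1 : R) `<=` U]^°.
suff -> : X @^-1` U = \bigcup_k \bigcup_N \bigcap_(j in [set j | (N <= j)%N]) g j @^-1` V k.
  apply: bigcupT_measurable => k; apply: bigcupT_measurable => N.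
  apply: bigcap_measurable => // [|j _]; first by exists N => /=.
  rewrite -[_ @^-1` _]setTI; apply: mg => //.
  by apply: skorokhod_open_measurable; exact: open_interior.
apply/seteqP; split=> [w Uw|w [k _ [N _ gV]]].
  have /nbhs_ballP[e e0 eU] : nbhs (X w) U by exact: open_nbhs_nbhs.
  have [k ke] : exists k : nat, k.+1%:R^-1 < e / 2.
    have e20 : 0 < (e / 2)^-1 by rewrite invr_gt0 divr_gt0.
    exists (Num.truncn ((e / 2)^-1)); rewrite -[ltRHS]invrK ltf_pV2 ?posrE//.
    exact: truncnS_gt.
  have XV : V k (X w).
    apply/nbhs_ballP; exists (e / 2) => /=; first by rewrite divr_gt0.
    move=> y Xy z yz; apply: eU; rewrite [e]splitr; apply: ball_triangle Xy _.
    by apply: le_ball yz; exact: ltW.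
  have /nbhs_ballP[e' e'0 e'V] : nbhs (X w) (V k).
    by apply: open_nbhs_nbhs; split => //; exact: open_interior.
  have [N NP] := gX w _ e'0.
  by exists k => //; exists N => // j /= Nj; apply: e'V; apply: ball_sym; exact: NP.
have k0 : 0 < k.+1%:R^-1 :> R by rewrite invr_gt0.
have [N' N'P] := gX w _ k0.
have := gV (maxn N N') (leq_maxl _ _) => /interior_subset; apply.
by apply: N'P; rewrite leq_maxr.
Qed.

(** The limit inherits continuity from a vanishing oscillation: the [z j] may jump, but at scale
    [h j] they move by at most [r j]. *)
Lemma skorokhod_uniform_limit (z : nat -> skorokhod R) (r h : nat -> R) :
  (r @ \oo --> 0) -> (forall j, 0 < h j) ->
  (forall j k (t : R), (j <= k)%N -> t \in `[0, 1] -> `|z k t - z j t| <= r j) ->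
  (forall j (s t : R), s \in `[0, 1] -> t \in `[0, 1] -> `|s - t| <= h j ->
    `|z j s - z j t| <= r j) ->
  exists2 x : skorokhod R, C01 x &
    forall j (t : R), t \in `[0, 1] -> `|x t - z j t| <= r j.
Proof.
move=> r0 h0 zr zh; have rsmall (e : R) : 0 < e -> exists j, r j < e.
  move=> e0; have /cvgrPdist_lt/(_ e e0)[N _ /(_ N (leqnn N))] := r0.
  by rewrite sub0r normrN => /ltr_normlW Nr; exists N.
pose f t : R := limn (fun k => z k t).
have zc t : t \in `[0, 1] -> (fun k => z k t) @ \oo --> f t.
  move=> t01; apply/cauchy_cvgP/cauchy_exP => e e0.
  have [j je] := rsmall e e0; exists (z j t); exists j => // k /= jk.
  by rewrite -ball_normE /= distrC; apply: le_lt_trans je; exact: zr.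
have fz j t : t \in `[0, 1] -> `|f t - z j t| <= r j.
  move=> t01; have c : (fun k => `|z k t - z j t|) @ \oo --> `|f t - z j t|.
    by apply: cvg_norm; apply: cvgB; [exact: zc|exact: cvg_cst].
  rewrite -(cvg_lim _ c)//; apply: limr_le; first by apply/cvg_ex; exists `|f t - z j t|.
  by exists j => // k /= jk; exact: zr.
have f_out : f \_ `[0, 1]%classic = f.
  apply/funext => t; rewrite patchE; case: ifPn => // /negP t01; rewrite /f.
  have -> : (fun k => z k t) = cst 0.
    apply/funext => k; apply: skorokhod_outE; apply/negP => h01; apply: t01.
    by rewrite inE.
  by rewrite lim_cst.
have fC : {within `[0, 1]%classic, continuous f}.
  apply/within01P => t t01 e e0.
  have [j je] := rsmall (e / 4) (divr_gt0 e0 (ltr0n R 4)).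
  exists (h j) => // s s01 /ltW ts.
  have := zh j _ _ t01 s01 ts; have := fz j t t01; have := fz j s s01.
  rewrite !ler_norml !ltr_norml => /andP[? ?] /andP[? ?] /andP[? ?].
  by apply/andP; split; lra.
by exists (Skorokhod (within01_cadlag fC) f_out).
Qed.

End skorokhod_lemmas.

(** * Limits of processes that are Cauchy in probability *)

Section limit_process.
Context d (T : measurableType d) (R : realType) (mu : probability T R).

(** The expected sum is at most [c], so the sum is finite almost surely. [G] is an explicit
    measurable set because the limit process is defined by cases on it. *)
Lemma summable_ae (Y : nat -> T -> R) (c : R) : 0 <= c ->
  (forall j, measurable_fun setT (Y j)) -> (forall j w, 0 <= Y j w) ->
  (forall j, (\int[mu]_w (Y j w)%:E <= (c / (2 ^ j.+1)%:R)%:E)%E) ->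
  exists G : set T, [/\ measurable G, mu (~` G) = 0%E &
    forall w, G w -> cvgn (series (Y ^~ w))].
Proof.
move=> c0 mY Y0 iY; pose S w : \bar R := (\sum_(j <oo) (Y j w)%:E)%E.
have mYE j : measurable_fun setT (EFin \o Y j) by exact/measurable_EFinP.
have mS : measurable_fun setT S.
  by apply: ge0_emeasurable_sum => [j w _ _|j _]; [rewrite lee_fin|exact: mYE].
have S0 w : (0 <= S w)%E by apply: nneseries_ge0 => *; rewrite lee_fin.
have iS : (\int[mu]_w S w <= c%:E)%E.
  rewrite integral_nneseries//; last by move=> *; rewrite lee_fin.
  apply: le_trans (epsilon_trick0 xpredT c0); apply: lee_nneseries => // j _ _.
  by apply: integral_ge0 => w _; rewrite lee_fin.
have intS : mu.-integrable setT S.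
  apply/integrableP; split => //; under eq_integral => w _ do rewrite gee0_abs//.
  by apply: le_lt_trans iS _; rewrite ltry.
have mG : measurable [set w | (S w < +oo)%E].
  have -> : [set w | (S w < +oo)%E] = ~` (setT `&` S @^-1` [set +oo%E]).
    rewrite setTI; apply/seteqP; split => w /=; first by move=> + Soo; rewrite Soo ltxx.
    by rewrite ltey => /eqP.
  by apply: measurableC; apply: mS => //; exact: emeasurable_set1.
exists [set w | (S w < +oo)%E]; split => //.
  have [N [mN N0 SN]] := integrable_ae measurableT intS.
  apply/eqP; rewrite eq_le measure_ge0 andbT -N0.
  rewrite le_measure ?inE//; first exact: measurableC.
  move=> w /= Sw; apply: SN => /= /(_ I) Sfin; apply: Sw.
  by rewrite ltey_eq Sfin.
move=> w Sw; apply: nondecreasing_is_cvgn.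
  by apply: nondecreasing_series => n _ _.
exists (fine (S w)) => _ [n _ <-].
rewrite -lee_fin fineK; last by rewrite ge0_fin_numE.
rewrite /series /= -sumEFin; apply: nneseries_lim_ge => *.
by rewrite lee_fin.
Qed.

Variable X_ : nat -> T -> skorokhod R.
Hypothesis mX : forall n, measurable_fun setT (X_ n).

Definition uniformly_close n m (h : R) (Y : T -> R) w : Prop :=
  (forall t, t \in `[0, 1] -> `|X_ m w t - X_ n w t| <= Y w) /\
  (forall s t, s \in `[0, 1] -> t \in `[0, 1] -> `|s - t| <= h ->
     `|X_ n w s - X_ n w t| <= Y w).

Hypothesis X_cauchy : forall e : R, 0 < e -> exists n (h : R), 0 < h /\
  forall m, (n <= m)%N -> exists Y : T -> R,
    [/\ measurable_fun setT Y, forall w, 0 <= Y w,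
        (\int[mu]_w (Y w)%:E <= e%:E)%E & forall w, uniformly_close n m h Y w].

(** The limit is built along times [nh j] with errors of mean at most [2^-(j+1)]. Convergence of the
    whole sequence of integrals follows by extracting, from any failure, a subsequence that
    converges almost surely. *)
Lemma limit_process : exists X : T -> skorokhod R,
  [/\ measurable_fun setT X, forall w, C01 (X w) &
   forall f : skorokhod R -> R, continuous f -> bounded_fun f ->
     (\int[mu]_w (f (X_ n w))%:E)%E @[n --> \oo] --> (\int[mu]_w (f (X w))%:E)%E].
Proof.
pose e j : R := 1 / (2 ^ j.+1)%:R.
have e0 j : 0 < e j by rewrite divr_gt0// ltr0n expn_gt0.
have [nh nhP] := choice (fun j => X_cauchy (e0 j)).
have [hh hhP] := choice nhP.
have YH (q : nat * nat) : exists Y : T -> R, (nh q.1 <= q.2)%N ->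
    [/\ measurable_fun setT Y, forall w, 0 <= Y w,
        (\int[mu]_w (Y w)%:E <= (e q.1)%:E)%E &
        forall w, uniformly_close (nh q.1) q.2 (hh q.1) Y w].
  have [nm|/negP nm] := boolP (nh q.1 <= q.2)%N; last by exists (cst 0).
  by have [_ /(_ q.2 nm)[Y YP]] := hhP q.1; exists Y.
have [YY YP] := choice YH.
(* The times [nh j] need not increase, so consecutive ones are compared through the larger of the
   two. *)
pose mm j := maxn (nh j) (nh j.+1).
pose Z j w := YY (j, mm j) w + YY (j.+1, mm j) w.
have YPl j := YP (j, mm j) (leq_maxl _ _).
have YPr j := YP (j.+1, mm j) (leq_maxr _ _).
have Z0 j w : 0 <= Z j w.
  by have [_ ? _ _] := YPl j; have [_ ? _ _] := YPr j; rewrite addr_ge0.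
have mZ j : measurable_fun setT (Z j).
  by have [? _ _ _] := YPl j; have [? _ _ _] := YPr j; exact: measurable_funD.
have iZ j : (\int[mu]_w (Z j w)%:E <= (2 / (2 ^ j.+1)%:R)%:E)%E.
  have [ma a0 ia _] := YPl j; have [mb b0 ib _] := YPr j.
  under eq_integral do rewrite EFinD.
  rewrite ge0_integralD//; [|by move=> *; rewrite lee_fin|exact/measurable_EFinP
    |by move=> *; rewrite lee_fin|exact/measurable_EFinP].
  apply: le_trans (leeD ia ib) _; rewrite -EFinD lee_fin /e /=.
  rewrite [(2 ^ j.+2)%N]expnS natrM.
  have : 0 < (2 ^ j.+1)%:R^-1 :> R by rewrite invr_gt0 ltr0n expn_gt0.
  by rewrite !div1r invfM; lra.
have [G [mG muG GZ]] := summable_ae (ler0n R 2) mZ Z0 iZ.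
pose r w j : R := limn (series (Z ^~ w)) - series (Z ^~ w) j.
have nd w : nondecreasing_seq (series (Z ^~ w)).
  by apply: nondecreasing_series => n _ _.
have r0 w : G w -> r w @ \oo --> 0.
  by move=> /GZ cS; rewrite -[0](subrr (limn (series (Z ^~ w)))); apply: cvgB => //; exact: cvg_cst.
have Zr w j : G w -> Z j w <= r w j.
  move=> /GZ cS; rewrite /r lerBrDr; have := nondecreasing_cvgn_le (nd w) cS j.+1.
  by rewrite /series /= big_nat_recr //= addrC.
have step w j (t : R) : t \in `[0, 1] -> `|X_ (nh j.+1) w t - X_ (nh j) w t| <= Z j w.
  move=> t01; have [_ _ _ /(_ w)[/(_ t t01) ca _]] := YPl j.
  have [_ _ _ /(_ w)[/(_ t t01) cb _]] := YPr j.
  have := ler_distD (X_ (mm j) w t) (X_ (nh j.+1) w t) (X_ (nh j) w t).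
  by move/le_trans; apply; rewrite /Z addrC lerD// distrC.
have tele w j k (t : R) : (j <= k)%N -> t \in `[0, 1] ->
    `|X_ (nh k) w t - X_ (nh j) w t| <= series (Z ^~ w) k - series (Z ^~ w) j.
  move=> /subnK <- t01; elim: (k - j)%N => [|i IH]; first by rewrite !subrr normr0.
  have := ler_distD (X_ (nh (i + j)%N) w t) (X_ (nh (i + j).+1%N) w t) (X_ (nh j) w t).
  move/le_trans; apply; have := step w (i + j)%N t t01.
  have -> : series (Z ^~ w) (i.+1 + j)%N = series (Z ^~ w) (i + j)%N + Z (i + j)%N w.
    by rewrite addSn /series /= big_nat_recr.
  by lra.
have XH w : exists x : skorokhod R, C01 x /\ (G w -> forall j (t : R), t \in `[0, 1] ->
    `|x t - X_ (nh j) w t| <= r w j).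
  have [Gw|nGw] := pselect (G w); last first.
    exists point; split => //; apply: continuous_subspaceT => t.
    exact: cvg_cst.
  have [j|j k t jk t01|j s t s01 t01 st|x xC xz] :=
      @skorokhod_uniform_limit R (fun j => X_ (nh j) w) (r w) hh (r0 w Gw).
  - by have [] := hhP j.
  - apply: le_trans (tele w j k t jk t01) _; rewrite lerD2r.
    exact: nondecreasing_cvgn_le (nd w) (GZ w Gw) k.
  - have [_ _ _ /(_ w)[_ /(_ s t s01 t01 st)]] := YPl j.
    move/le_trans; apply; apply: le_trans (Zr w j Gw); rewrite lerDl.
    by have [_ ? _ _] := YPr j.
  - by exists x.
have [X XP] := choice XH.
have XC w : C01 (X w) by have [] := XP w.
have Xr w : G w -> forall j (t : R), t \in `[0, 1] -> `|X w t - X_ (nh j) w t| <= r w j.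
  by have [] := XP w.
(* The default off [G] keeps the limit continuous for every [w] and measurable. *)
pose X' w := if w \in G then X w else point.
have mX' : measurable_fun setT X'.
  apply: (@skorokhod_measurable_limit R _ _
    (fun j w => if w \in G then X_ (nh j) w else point)).
    move=> j; apply: measurable_fun_ifT => //.
    apply: (measurable_fun_bool true); rewrite setTI.
    by rewrite (_ : _ @^-1` _ = G)//; apply/seteqP; split=> w; [exact: set_mem|exact: mem_set].
  move=> w eps eps0; rewrite /X'; case: ifPn => [/set_mem Gw|_]; last first.
    by exists 0%N => j _; exact: ballxx.
  have /cvgrPdist_lt/(_ eps eps0)[N _ NP] := r0 w Gw.
  exists N => j Nj; apply: (@uniform_skorokhod_ball R _ _ (r w j)).
    by have := NP j Nj; rewrite /= sub0r normrN => /ltr_normlW.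
  by move=> t t01; rewrite distrC; exact: Xr.
exists X'; split => //.
  move=> w; rewrite /X'; case: ifPn => // _.
  by apply: continuous_subspaceT => t; exact: cvg_cst.
move=> f cf bf.
have mf := skorokhod_continuous_measurable cf.
have mfX n : measurable_fun setT (EFin \o (fun w => f (X_ n w))).
  by apply/measurable_EFinP; exact: measurableT_comp.
have mfX' : measurable_fun setT (EFin \o (fun w => f (X' w))).
  by apply/measurable_EFinP; exact: measurableT_comp.
have [M [_ MP]] := bf.
have fM x : `|f x| <= M + 1 by apply: MP; rewrite ?ltrDl.
move=> U nU; apply: contrapT => notU.
have H N : exists m, (N <= m)%N /\ ~ U (\int[mu]_w (f (X_ m w))%:E)%E.
  apply: contrapT => Hno; apply: notU; exists N => // m /= Nm.
  by apply: contrapT => nUm; apply: Hno; exists m.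
(* Times [m_ j >= nh j] at which the integral stays outside [U]. Their distances to the times [nh j]
   have summable means, so dominated convergence contradicts the choice. *)
have [m_ mP] := choice (fun j => H (nh j)).
have YPm j := YP (j, m_ j) (proj1 (mP j)).
have [G' [mG' muG' GY]] := @summable_ae (fun j => YY (j, m_ j)) 1 ler01
  (fun j => let: And4 a _ _ _ := YPm j in a) (fun j => let: And4 _ a _ _ := YPm j in a)
  (fun j => let: And4 _ _ a _ := YPm j in a).
have Xm w : G w -> G' w -> f (X_ (m_ j) w) @[j --> \oo] --> f (X' w).
  move=> Gw /GY /cvg_series_cvg_0 Y00; apply: continuous_cvg; first exact: cf.
  apply/cvg_ballP => eps eps0; rewrite /X' mem_set//.
  have eps20 : 0 < eps / 2 by rewrite divr_gt0.
  have /cvgrPdist_lt/(_ _ eps20) Ysmall := Y00.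
  have /cvgrPdist_lt/(_ _ eps20) rsmall := r0 w Gw.
  near=> j.
  apply: (@uniform_skorokhod_ball R _ _ (r w j + YY (j, m_ j) w)).
    rewrite [eps]splitr; apply: ltrD.
      apply: (le_lt_trans (ler_norm _)); rewrite -normrN -sub0r.
      by near: j; exact: rsmall.
    apply: (le_lt_trans (ler_norm _)); rewrite -normrN -sub0r.
    by near: j; exact: Ysmall.
  move=> t t01; have [_ _ _ /(_ w)[/(_ t t01) ca _]] := YPm j.
  have := ler_distD (X_ (nh j) w t) (X w t) (X_ (m_ j) w t).
  by move/le_trans; apply; rewrite lerD// ?Xr// distrC.
have cv : {ae mu, forall w, setT w ->
    (f (X_ (m_ j) w))%:E @[j --> \oo] --> (f (X' w))%:E}.
  exists (~` G `|` ~` G'); split.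
  - by apply: measurableU; exact: measurableC.
  - by apply: null_set_setU => //; exact: measurableC.
  - move=> w /= nw; apply: contrapT => /not_orP[/contrapT Gw /contrapT G'w].
    by apply: nw => _; apply: cvg_EFin; [exact: nearW|exact: Xm].
have dom : {ae mu, forall w j, setT w ->
    (`|(f (X_ (m_ j) w))%:E| <= cst (M + 1)%:E w)%E}.
  by apply: aeW => w j _; rewrite lee_fin.
have intM : mu.-integrable setT (cst (M + 1)%:E).
  exact: finite_measure_integrable_cst.
have [_ _ cvgI] := dominated_convergence measurableT (fun j => mfX (m_ j)) mfX'
  cv intM dom.
have /cvgI : nbhs (\int[mu]_w (f (X' w))%:E)%E U by [].
move=> [N _ /(_ N (leqnn N))] /=.
by have [_] := mP N.
Unshelve. all: by end_near. Qed.

End limit_process.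

(** * The coupling on the unit interval *)

Section coding.
Context {R : realType}.

(** The least significant digit belongs to the latest customer. *)
Fixpoint code_digits (n k : nat) : seq nat :=
  if n is m.+1 then (k %% n)%N :: code_digits m (k %/ n) else [::].

Lemma size_code_digits n k : size (code_digits n k) = n.
Proof. by elim: n k => //= n IH k; rewrite IH. Qed.

Lemma fexp_code_digits n (F : seq nat -> R) :
  fexp (digits n) F = n`!%:R^-1 * \sum_(k < n`!) F (code_digits n k).
Proof.
elim: n F => [|n IH] F; first by rewrite fexp_digits0 fact0 invr1 mul1r big_ord1.
rewrite fexp_digitsS IH -mulr_sumr mulrA factS natrM invfM [_^-1 * _^-1]mulrC.
congr (_ * _); rewrite mulnC -(big_mkord xpredT (fun k => F (code_digits n.+1 k))).
rewrite big_nat_mul big_mkord; apply: eq_bigr => k _.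
rewrite -[X in index_iota X _]add0n mulSn big_addn addnK big_mkord; apply: eq_bigr => i _ /=.
by rewrite addnC modnMDl divnMDl// divn_small ?addn0 ?modn_small.
Qed.

(* The mixed radix expansion of a uniform [u] provides independent digits;
   the absolute value only matters outside [0, 1]. *)
Definition code (n : nat) (u : R) : nat := Num.truncn (n`!%:R * `|u|).

Definition uniform_digits n (u : R) : seq nat := code_digits n (code n u).

(** Nested integer parts: dividing the code of size [n + 1] by [n + 1] gives that of size [n]. Hence
    one [u] drives the restaurants of all sizes. *)
Lemma code_div n u : (code n.+1 u %/ n.+1)%N = code n u.
Proof.
have f0 m : 0 <= m`!%:R * `|u| by rewrite mulr_ge0.
apply/eqP; rewrite eqn_leq -[X in (X <= _)%N]mul1n; apply/andP; split.
  rewrite mul1n /code truncn_ge_nat// -(ler_pM2l (ltr0Sn R n)) mulrA -!natrM -factS.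
  by rewrite -truncn_ge_nat// mulnC leq_divM.
rewrite leq_divRL// /code truncn_ge_nat// factS !natrM mulrC -mulrA ler_pM2l//.
by rewrite -truncn_ge_nat.
Qed.

Lemma drop_uniform_digits k n u :
  drop k (uniform_digits (k + n) u) = uniform_digits n u.
Proof.
elim: k => [|k IH]; first by rewrite drop0.
by rewrite addSn /uniform_digits /= code_div.
Qed.

Local Notation mu := (uniform_prob (@ltr01 R)).

Lemma code_eqE n u k : (code n u == k) = (k%:R <= n`!%:R * `|u| < k.+1%:R).
Proof.
have f0 : 0 <= n`!%:R * `|u| by rewrite mulr_ge0.
by rewrite eqn_leq andbC /code truncn_ge_nat// -ltnS ltnNge truncn_ge_nat// -ltNge.
Qed.

Lemma measurable_code n k : measurable [set u : R | code n u = k].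
Proof.
have -> : [set u : R | code n u = k] =
    (fun u => n`!%:R * `|u|) @^-1` `[k%:R, k.+1%:R[%classic.
  by apply/seteqP; split=> u /=; rewrite in_itv/= -code_eqE => /eqP.
rewrite -[X in measurable X]setTI.
have : measurable_fun setT (fun u : R => n`!%:R * `|u|).
  apply: measurable_funM; first exact: measurable_cst.
  exact: normr_measurable.
by apply.
Qed.

(** [code n] is measurable with countably many values, so [g] may be arbitrary. *)
Lemma measurable_code_comp d (T : measurableType d) n (g : nat -> T) :
  measurable_fun setT (fun u : R => g (code n u)).
Proof.
move=> _ A mA; rewrite setTI.
have -> : (fun u : R => g (code n u)) @^-1` A =
    \bigcup_(k in [set k | A (g k)]) [set u : R | code n u = k].
  by apply/seteqP; split=> [u /= Au|u [k /= Ak ->]//]; exists (code n u).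
by apply: bigcup_measurable => k _; exact: measurable_code.
Qed.

Lemma integral_code n (psi : nat -> R) : (forall k, 0 <= psi k) ->
  (\int[mu]_u (psi (code n u))%:E = (n`!%:R^-1 * \sum_(k < n`!) psi k)%:E)%E.
Proof.
move=> psi0; have f0 : 0 < n`!%:R :> R by rewrite ltr0n fact_gt0.
have mpsi : measurable_fun setT (fun u : R => (psi (code n u))%:E).
  by apply/measurable_EFinP; exact: (measurable_code_comp n psi).
rewrite integral_uniform//; last by move=> u; rewrite lee_fin.
(* The endpoint 1 is removed because its code [n!] lies outside the range of the sum. *)
rewrite subr0 invr1 mul1e -integral_itv_bndo_bndc; last exact: measurable_funTS.
pose I k := `[(k%:R / n`!%:R : R), k.+1%:R / n`!%:R[%classic.
have mI k : measurable (I k) by exact: measurable_itv.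
have IE u k : 0 <= u -> (code n u == k) = (u \in I k).
  move=> u0; rewrite code_eqE ger0_norm// mem_setE in_itv/=.
  by rewrite ler_pdivrMr// ltr_pdivlMr// mulrC.
transitivity (\int[lebesgue_measure]_(u in `[0%R, 1%R[)
   (\sum_(k < n`!) (psi k)%:E * (\1_(I k) u)%:E))%E.
  apply: eq_integral => u; rewrite inE /= in_itv/= => /andP[u0 u1].
  have cn : (code n u < n`!)%N.
    rewrite ltnNge /code truncn_ge_nat ?mulr_ge0// -ltNge ger0_norm//.
    by rewrite gtr_pMr.
  rewrite (bigD1 (Ordinal cn)) //= big1 ?adde0; last first.
    move=> k; rewrite -val_eqE /= eq_sym IE// indicE => /negbTE ->.
    by rewrite mule0.
  by rewrite indicE -IE// eqxx mule1.
rewrite ge0_integral_sum//; last 2 first.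
- move=> k; apply: measurable_funTS; apply/measurable_EFinP.
  by apply: measurable_funM; [exact: measurable_cst|apply: measurable_indic; exact: mI].
- by move=> k u _; rewrite -EFinM lee_fin mulr_ge0.
rewrite mulr_sumr -sumEFin; apply: eq_bigr => k _.
rewrite ge0_integralZl ?lee_fin//; last first.
  by apply: measurable_funTS; apply/measurable_EFinP; apply: measurable_indic; exact: mI.
rewrite integral_indic//; last exact: mI.
rewrite (_ : I k `&` _ = I k); last first.
  apply/setIidPl => u; rewrite /I /= !in_itv/= => /andP[h1 h2]; apply/andP; split.
    by apply: le_trans h1; rewrite divr_ge0.
  apply: lt_le_trans h2 _; rewrite ler_pdivrMr// mul1r ler_nat.
  exact: ltn_ord.
transitivity ((psi k)%:E * (n`!%:R^-1)%:E)%E; last by rewrite -EFinM mulrC.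
congr (_ * _)%E; apply: etrans (lebesgue_measure_itv _) _.
rewrite /= lte_fin ltr_pM2r ?invr_gt0// ltr_nat ltnSn.
by rewrite -EFinD -mulrBl -natrB// subSnn mul1r.
Qed.

Lemma integral_uniform_digits n (F : seq nat -> R) : (forall ds, 0 <= F ds) ->
  (\int[mu]_u (F (uniform_digits n u))%:E = (fexp (digits n) F)%:E)%E.
Proof.
move=> F0; rewrite fexp_code_digits.
exact: (integral_code n (fun k => F0 (code_digits n k))).
Qed.

End coding.

(** * Coupled versions of the processes *)

Section coupling.
Context {R : realType} (theta : R).
Hypothesis theta_gt0 : 0 < theta.

Let p := theta / (1 + theta).

(** Each choice of a table is realised by an insertion into a permutation, so [process_of_type]
    never takes its default value on tables of the right size. *)
Lemma cycle_type_tables n ds : size ds = n ->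
  exists s : {perm 'I_n}, perm_eq (cycle_type s) (tables ds).
Proof.
elim: ds n => [|i ds IH] _ <- /=.
  by exists 1%g; rewrite cycle_type0.
have [s sds] := IH _ erefl; set l := tables ds in sds *.
have := table_le l i; rewrite leq_eqVlt => /orP[/eqP ->|].
  exists (insert_cycle s ord_max); apply: perm_trans (cycle_type_new s) _.
  by rewrite incr_nth_size perm_sym perm_rcons perm_cons perm_sym.
move=> il; have : nth 0%N l (table l i) \in cycle_type s.
  by rewrite (perm_mem sds) mem_nth.
move=> /mapP[c]; rewrite mem_enum => /imsetP[x _ ->] lx.
exists (insert_cycle s (lift ord_max x)); apply: perm_trans (cycle_type_join s x) _.
rewrite perm_sym; apply: perm_trans (perm_incr_nth il) _.
by rewrite lx perm_cons perm_rem// perm_sym.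
Qed.

Lemma process_cycle_type n (s s' : {perm 'I_n}) :
  perm_eq (cycle_type s) (cycle_type s') ->
  process (fun=> theta) s = process (fun=> theta) s' :> skorokhod R.
Proof.
move=> ss'; apply: skorokhod_eq => t /=; rewrite !patchE; case: ifP => // _.
by rewrite !process_fun_cdf// (cdf_perm _ _ ss').
Qed.

(** Digits yield sizes rather than a permutation. Any permutation with these cycle lengths will do,
    since the process depends only on its cycle type. *)
Definition process_of_type n (l : seq nat) : skorokhod R :=
  if [pick s : {perm 'I_n} | perm_eq (cycle_type s) l] is Some s
  then process (fun=> theta) s else point.

Lemma process_of_cycle_type n (s : {perm 'I_n}) :
  process_of_type n (cycle_type s) = process (fun=> theta) s.
Proof.
rewrite /process_of_type; case: pickP => [s' /process_cycle_type //|/(_ s)].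
by rewrite perm_refl.
Qed.

Lemma process_of_type_perm n l l' :
  perm_eq l l' -> process_of_type n l = process_of_type n l'.
Proof.
move=> ll'; rewrite /process_of_type (@eq_pick _ _ (fun s : {perm 'I_n} => perm_eq (cycle_type s) l'))//.
by move=> s; rewrite (permPr ll').
Qed.

Lemma process_of_tables ds t : t \in `[0, 1] ->
  process_of_type (size ds) (tables ds) t = cdf p (tables ds) t.
Proof.
move=> t01; have [s sds] := cycle_type_tables (erefl (size ds)).
rewrite -(process_of_type_perm _ sds) process_of_cycle_type /= patchE mem_set//.
by rewrite process_fun_cdf// (cdf_perm _ _ sds).
Qed.

Definition coupled n (u : R) : skorokhod R :=
  process_of_type n (tables (uniform_digits n u)).

Lemma measurable_coupled n :
  measurable_fun setT (coupled n : measurableTypeR R -> skorokhod R).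
Proof. exact: (measurable_code_comp n (fun k => process_of_type n (tables (code_digits n k)))). Qed.

Definition mfun_of d d' (S : measurableType d) (T : measurableType d') (X : S -> T)
    (mX : measurable_fun setT X) : {mfun S >-> T} :=
  HB.pack X (isMeasurableFun.Build _ _ S T X mX).

(** The indicator of [A] composed with [process_of_type] is a symmetric function of the sizes, so
    its mean over the digits is its mean over uniform permutations. *)
Lemma process_law_coupled n (A : set (skorokhod R)) : measurable A ->
  process_law (fun=> theta) n A =
  distribution (uniform_prob (@ltr01 R)) (mfun_of (measurable_coupled n)) A.
Proof.
move=> mA; have mXA : measurable (coupled n @^-1` A : set (measurableTypeR R)).
  by rewrite -[X in measurable X]setTI; exact: measurable_coupled.
transitivity (\int[uniform_prob (@ltr01 R)]_u
    (\1_A (process_of_type n (tables (uniform_digits n u))))%:E)%E; last first.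
  transitivity (\int[uniform_prob (@ltr01 R)]_u (\1_(coupled n @^-1` A) u)%:E)%E => //.
  by rewrite integral_indic// setIT.
rewrite (integral_uniform_digits n (F := fun ds => \1_A (process_of_type n (tables ds)))) //.
rewrite (@fexp_tables_cycle_type R n (fun l => \1_A (process_of_type n l))); last first.
  by move=> l l' ll'; rewrite (process_of_type_perm _ ll').
congr EFin; rewrite mulrC; congr (_ * _).
rewrite -sum1_card natr_sum big_mkcond; apply: eq_bigr => s _.
rewrite process_of_cycle_type indicE inE.
have -> : (s \in process (fun=> theta) @^-1` A) = (process (fun=> theta) s \in A).
  by apply/idP/idP => /set_mem sA; exact: mem_set.
by case: (_ \in A).
Qed.

Lemma coupled_cauchy (e : R) : 0 < e -> exists n (h : R), 0 < h /\
  forall m, (n <= m)%N -> exists Y : measurableTypeR R -> R,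
    [/\ measurable_fun setT Y, forall w, 0 <= Y w,
        (\int[uniform_prob (@ltr01 R)]_w (Y w)%:E <= e%:E)%E &
        forall w, uniformly_close coupled n m h Y w].
Proof.
have p01 : 0 < p < 1.
  by rewrite divr_gt0 ?addr_gt0//= ltr_pdivrMr ?addr_gt0// mul1r ltrDr.
move=> e0; have [n [h [n0 h0 nhP]]] := main_estimate p01 e0.
exists n, h; split => // m nm; have [Phi [Phi0 PhiE PhiP]] := nhP m nm.
exists (fun u => Phi (uniform_digits m u)); split => //.
- exact: (measurable_code_comp m (fun k => Phi (code_digits m k))).
- by rewrite (integral_uniform_digits m Phi0) lee_fin.
- move=> u; set ds := uniform_digits m u.
  have dsm : size ds = m by exact: size_code_digits.
  have dsn : drop (m - n) ds = uniform_digits n u.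
    by rewrite /ds -{2}(subnK nm) drop_uniform_digits.
  have cm t : t \in `[0, 1] -> coupled m u t = cdf p (tables ds) t.
    by move=> t01; rewrite -process_of_tables// dsm.
  have cn t : t \in `[0, 1] -> coupled n u t = cdf p (tables (drop (m - n) ds)) t.
    by move=> t01; rewrite -process_of_tables// dsn size_code_digits.
  have [P1 P2] := PhiP ds dsm; split=> [t t01|s t s01 t01 st].
    by rewrite cm// cn.
  by rewrite !cn//; exact: P2.
Qed.

End coupling.

Theorem theorem2 (R : realType) (theta : R) (theta_gt0 : 0 < theta) :
  exists P : probability (skorokhod R) R,
    weakly_cvg (process_law (fun=> theta)) P /\
    exists A : set (skorokhod R),
      [/\ measurable A, A `<=` @C01 R & P A = 1%E].
Proof.
have [X [mX XC Xcvg]] :=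
  limit_process (measurable_coupled theta) (coupled_cauchy theta_gt0).
exists (distribution (uniform_prob (@ltr01 R)) (mfun_of mX)); split; last first.
  exists (@C01 R); split => //; first exact: C01_measurable.
  transitivity (uniform_prob (@ltr01 R) (X @^-1` @C01 R)) => //.
  rewrite (_ : _ @^-1` _ = setT) ?probability_setT//.
  by apply/seteqP; split => // u _; exact: XC.
move=> f cf bf; have mf := skorokhod_continuous_measurable cf.
(* The change of variables needs integrability, which the boundedness of [f] supplies. *)
have int_law Y (mY : measurable_fun setT (Y : measurableTypeR R -> skorokhod R)) :
    (\int[distribution (uniform_prob (@ltr01 R)) (mfun_of mY)]_x (f x)%:E =
     \int[uniform_prob (@ltr01 R)]_u (f (Y u))%:E)%E.
  rewrite (integral_distribution (f := EFin \o f))//; first exact/measurable_EFinP.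
  apply: (measurable_bounded_integrable (f := f \o Y)) => //.
  - by apply: le_lt_trans (probability_le1 _ measurableT) _; rewrite ltry.
  - exact: measurableT_comp.
  - have [M [Mr MP]] := bf; exists M; split => // N MN u _; exact: MP.
rewrite int_law; apply: cvg_trans (Xcvg f cf bf).
apply: near_eq_cvg; apply: nearW => n /=.
rewrite -(int_law _ (measurable_coupled theta n)).
apply: eq_measure_integral => A mA _; apply/esym.
exact: (process_law_coupled theta_gt0).
Qed.
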